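(* Let $\mathcal H$ and $(\mathcal G_i)_{1\leq i\leq m}$ be real Hilbert spaces, where $m$ is a strictly positive integer. Let $z\in\mathcal H$, let $\rho\in\left]0,+\infty\right[$, and let $A\colon\mathcal H\to2^{\mathcal H}$ be maximally monotone. For every $i\in\{1,\ldots,m\}$, let $r_i\in\mathcal G_i$, let $B_i\colon\mathcal G_i\to2^{\mathcal G_i}$ be maximally monotone, let $\nu_i\in\left]0,+\infty\right[$, let $D_i\colon\mathcal G_i\to2^{\mathcal G_i}$ be maximally monotone and $\nu_i$-strongly monotone, and let $L_i\colon\mathcal H\to\mathcal G_i$ be a nonzero bounded linear operator. Suppose that $$z\in\operatorname{ran}\Big(A+\sum_{i=1}^mL_i^*\big((B_i\,\square\,D_i)(L_i\cdot-r_i)\big)+\rho\,\mathrm{Id}\Big).$$ Consider the primal inclusion $$\text{(P)}\quad\text{find }\overline x\in\mathcal H\text{ such that }z\in A\overline x+\sum_{i=1}^mL_i^*\big((B_i\,\square\,D_i)(L_i\overline x-r_i)\big)+\rho\overline x,$$ and the dual inclusion $$\text{(D)}\quad\text{find }\overline{v_1}\in\mathcal G_1,\ldots,\overline{v_m}\in\mathcal G_m\text{ such that }(\forall i\in\{1,\ldots,m\})\quad r_i\in L_i\Big(J_{\rho^{-1}A}\Big(\rho^{-1}\Big(z-\sum_{j=1}^mL_j^*\overline{v_j}\Big)\Big)\Big)-B_i^{-1}\overline{v_i}-D_i^{-1}\overline{v_i}.$$ Set $$\beta=\frac{1}{\max_{1\leq i\leq m}\frac1{\nu_i}+\frac1\rho\sum_{1\leq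 i\leq m}\|L_i\|^2}.$$ Let $(a_n)_{n\in\mathbb N}$ be an absolutely summable sequence in $\mathcal H$, let $\alpha\in\left]0,+\infty\right[$, and let $(\eta_n)_{n\in\mathbb N}\in\ell_+^1(\mathbb N)$. For every $i\in\{1,\ldots,m\}$, let $v_{i,0}\in\mathcal G_i$, let $(b_{i,n})_{n\in\mathbb N}$ and $(d_{i,n})_{n\in\mathbb N}$ be absolutely summable sequences in $\mathcal G_i$, and let $(U_{i,n})_{n\in\mathbb N}$ be a sequence in $\mathcal P_\alpha(\mathcal G_i)$. Suppose that $$\mu=\max_{1\leq i\leq m}\sup_{n\in\mathbb N}\|U_{i,n}\|<+\infty\quad\text{and}\quad(\forall i\in\{1,\ldots,m\})(\forall n\in\mathbb N)\quad(1+\eta_n)U_{i,n+1}\succcurlyeq U_{i,n}.$$ Let $\varepsilon\in\left]0,\min\{1,2\beta/(\mu+1)\}\right]$, let $(\lambda_n)_{n\in\mathbb N}$ be a sequence in $[\varepsilon,1]$, and let $(\gamma_n)_{n\in\mathbb N}$ be a sequence in $[\varepsilon,(2\beta-\varepsilon)/\mu]$. For every $n\in\mathbb N$, set $$s_n=z-\sum_{i=1}^mL_i^*v_{i,n},\qquad x_n=J_{\rho^{-1}A}(\rho^{-1}s_n)+a_n,$$ and, for $i=1,\ldots,m$, $$w_{i,n}=v_{i,n}+\gamma_nU_{i,n}\big(L_ix_n-r_i-D_i^{-1}v_{i,n}-d_{i,n}\big),$$ $$v_{i,n+1}=v_{i,n}+\lambda_n\Big(J_{\gamma_nU_{i,n}B_i^{-1}}(w_{i,n})+b_{i,n}-v_{i,n}\Big).$$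 Then the following hold for the solution $\overline x$ to (P) and for some solution $(\overline{v_1},\ldots,\overline{v_m})$ to (D). (i) $(\forall i\in\{1,\ldots,m\})$ $v_{i,n}\rightharpoonup\overline{v_i}$ (weak convergence). In addition, $\overline x=J_{\rho^{-1}A}\big(\rho^{-1}\big(z-\sum_{i=1}^mL_i^*\overline{v_i}\big)\big)$. (ii) $x_n\to\overline x$ (strong convergence).
   Context: For a real Hilbert space $\mathcal H$ with scalar product $\langle\cdot\mid\cdot\rangle$ and norm $\|\cdot\|$: - For bounded self-adjoint linear operators $U,V$ on $\mathcal H$, $U\succcurlyeq V$ means $\langle Ux\mid x\rangle\geq\langle Vx\mid x\rangle$ for every $x\in\mathcal H$. For $\alpha\in[0,+\infty[$, $\mathcal P_\alpha(\mathcal H)$ is the set of bounded self-adjoint linear operators $U$ on $\mathcal H$ such that $U\succcurlyeq\alpha\,\mathrm{Id}$. - $\ell_+^1(\mathbb N)$ is the set of summable sequences in $[0,+\infty[$. A sequence $(a_n)$ in $\mathcal H$ is absolutely summable if $\sum_n\|a_n\|<+\infty$. - $L^*$ denotes the adjoint of a bounded linear operator $L$. - A set-valued operator $A\colon\mathcal H\to2^{\mathcal H}$ has graph $\operatorname{gra}A=\{(x,u)\mid u\in Ax\}$, domain $\operatorname{dom}A=\{x\mid Ax\neq\varnothing\}$, range $\operatorname{ran}A=\{u\mid(\exists x)\ u\in Ax\}$, and inverse $A^{-1}\colon u\mapsto\{x\mid u\in Ax\}$. It is monotone if $\langle x-y\mid u-v\rangle\geq0$ for all $(x,u),(y,v)\in\operatorname{gra}A$;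 maximally monotone if moreover its graph is not properly contained in the graph of another monotone operator; and $\nu$-strongly monotone if $A-\nu\,\mathrm{Id}$ is monotone. Sums and compositions with linear operators are taken pointwise on sets; e.g. $UA\colon x\mapsto\{Uu\mid u\in Ax\}$. - The resolvent of $A$ is $J_A=(\mathrm{Id}+A)^{-1}$. The parallel sum of $B$ and $D$ is $B\,\square\,D=(B^{-1}+D^{-1})^{-1}$. - The operators $D_i^{-1}$ and the resolvents appearing in the algorithm are single-valued and defined everywhere, so they are identified with functions. Under the stated assumptions the primal inclusion (P) has exactly one solution. *)

(* Defs.v *)
From HB Require Import structures.
From mathcomp Require Import all_boot all_order all_algebra.
From mathcomp Require Import all_classical all_reals all_analysis.

Set Implicit Arguments.
Unset Strict Implicit.
Unset Printing Implicit Defensive.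

Import Order.TTheory GRing.Theory Num.Theory.
Import numFieldNormedType.Exports.

Local Open Scope classical_set_scope.
Local Open Scope ring_scope.

(* Real Hilbert spaces: complete normed modules over R whose norm comes from
   a scalar product. *)
HB.mixin Record CompleteNormedModule_isHilbert (R : realType) V
    & CompleteNormedModule R V := {
  dotp : {dot V for idfun};
  dotp_norm : forall x : V, dotp x x = `|x| ^+ 2
}.

#[short(type="hilbertType")]
HB.structure Definition Hilbert (R : realType) :=
  {V of CompleteNormedModule_isHilbert R V & CompleteNormedModule R V}.

Notation "''<|' x , y |>" := (dotp x y)
  (at level 0, x at level 99, y at level 99, format "''<|' x ,  y |>")
  : ring_scope.

Section LinearOperators.
Variable R : realType.

(* The supremum is taken in R, hence meaningful for bounded L only. *)
Definition opnorm (H G : hilbertType R) (L : H -> G) : R :=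
  sup [set `|L x| | x in [set x | `|x| <= 1]].

(* The unique u such that <L x | y> = <x | u> for all x, when L is linear and
   bounded. *)
Definition adjoint (H G : hilbertType R) (L : H -> G) (y : G) : H :=
  xget 0 [set u | forall x, '<| L x, y |> = '<| x, u |>].

Definition self_adjoint (H : hilbertType R) (U : H -> H) : Prop :=
  forall x y, '<| U x, y |> = '<| x, U y |>.

Definition loewner_ge (H : hilbertType R) (U V : H -> H) : Prop :=
  forall x, '<| V x, x |> <= '<| U x, x |>.

(* The class P_alpha(H). *)
Definition Palpha (H : hilbertType R) (alpha : R) : set {linear H -> H} :=
  [set U : {linear H -> H} |
    [/\ bounded_near U (nbhs (0 : H)), self_adjoint U
      & loewner_ge U (alpha \*: idfun)]].

Definition weakly_cvg (H : hilbertType R) (u : nat -> H) (l : H) : Prop :=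
  forall y, (fun n => '<| u n, y |>) @ \oo --> '<| l, y |>.

End LinearOperators.

Section SetValuedOperators.
Variable R : realType.

Definition gra (H G : hilbertType R) (A : H -> set G) : set (H * G) :=
  [set p | A p.1 p.2].

Definition ran (H G : hilbertType R) (A : H -> set G) : set G :=
  [set u | exists x, A x u].

Definition op_inv (H G : hilbertType R) (A : H -> set G) : G -> set H :=
  fun u => [set x | A x u].

Definition op_id (H : hilbertType R) : H -> set H := fun x => [set x].

Definition op_add (H G : hilbertType R) (A B : H -> set G) : H -> set G :=
  fun x => [set u + v | u in A x & v in B x].

Definition op_sum (H G : hilbertType R) (m : nat) (F : 'I_m -> H -> set G) :
    H -> set G :=
  fun x => [set \sum_i u i | u in [set u : 'I_m -> G | forall i, F i x (u i)]].

(* The composition T A, for a single-valued operator T. *)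
Definition op_comp (H G K : hilbertType R) (T : G -> K) (A : H -> set G) :
    H -> set K :=
  fun x => T @` A x.

Definition op_scale (H G : hilbertType R) (c : R) (A : H -> set G) :
    H -> set G :=
  op_comp (fun u => c *: u) A.

Definition monotone_op (H : hilbertType R) (A : H -> set H) : Prop :=
  forall x y u v, A x u -> A y v -> 0 <= '<| x - y, u - v |>.

Definition max_monotone (H : hilbertType R) (A : H -> set H) : Prop :=
  monotone_op A /\
  forall A' : H -> set H, monotone_op A' -> ~ (gra A `<` gra A').

Definition strongly_monotone (H : hilbertType R) (nu : R) (A : H -> set H) :
    Prop :=
  monotone_op (op_add A (op_scale (- nu) (@op_id H))).

(* The function underlying a single-valued, everywhere defined operator. *)
Definition to_fun (H G : hilbertType R) (A : H -> set G) (x : H) : G :=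
  xget 0 (A x).

Definition resolvent (H : hilbertType R) (A : H -> set H) : H -> set H :=
  op_inv (op_add (@op_id H) A).

Definition J (H : hilbertType R) (A : H -> set H) : H -> H :=
  to_fun (resolvent A).

Definition parallel_sum (H : hilbertType R) (B D : H -> set H) : H -> set H :=
  op_inv (op_add (op_inv B) (op_inv D)).

End SetValuedOperators.

Section Inclusions.
Variables (R : realType) (m : nat) (H : hilbertType R).
Variable G : 'I_m -> hilbertType R.
Variables (z : H) (rho : R) (A : H -> set H) (r : forall i, G i).
Variables (B D : forall i, G i -> set (G i)) (L : forall i, {linear H -> G i}).

(* A + sum_i L_i^* ((B_i [] D_i) (L_i . - r_i)) + rho Id *)
Definition primal_op : H -> set H :=
  op_add
    (op_add A
      (op_sum (fun i => op_comp (adjoint (L i))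
        (fun x => parallel_sum (@B i) (@D i) (L i x - r i)))))
    (op_scale rho (@op_id R H)).

Definition primal_solution (x : H) : Prop := primal_op x z.

(* J_{A/rho} ((z - sum_j L_j^* v_j) / rho) *)
Definition primal_of_dual (v : forall i, G i) : H :=
  J (op_scale rho^-1 A) (rho^-1 *: (z - \sum_j adjoint (L j) (v j))).

Definition dual_solution (v : forall i, G i) : Prop :=
  forall i, [set L i (primal_of_dual v) - b - d
              | b in op_inv (@B i) (v i) & d in op_inv (@D i) (v i)] (r i).

End Inclusions.

(* Main.v *)
From HB Require Import structures.
Require Import Defs.
From mathcomp Require Import all_boot all_order all_algebra.
From mathcomp Require Import all_classical all_reals all_analysis.
From mathcomp Require Import ring lra.

Set Implicit Arguments.
Unset Strict Implicit.
Unset Printing Implicit Defensive.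

Import Order.TTheory GRing.Theory Num.Theory.
Import numFieldNormedType.Exports.

Local Open Scope classical_set_scope.
Local Open Scope ring_scope.

(** The dual inclusion asks for a family v such that - C v belongs to M v,
    where M acts by B_i^-1 on the component i, and C v has the components
    D_i^-1 v_i - L_i (x(v)) + r_i, with x(v) the primal point
    J_(A / rho) ((z - sum_j L_j^* v_j) / rho).  The algorithm is the
    forward-backward iteration for this inclusion, that is
    v <- J_(gamma U M) (v - gamma U (C v)), relaxed by lambda_n, in the metrics
    of the operators W_n = U_n^-1.  All errors are summable; a_n and d_n enter
    together, as an error in the value of C.

    The strong monotonicity of A + rho Id and of the D_i gives
      sum_i <v_i - v'_i | (C v - C v')_i> >=
        rho |x(v) - x(v')|^2 + sum_i nu_i |D_i^-1 v_i - D_i^-1 v'_i|^2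
    (dual_op_strong), from which C is beta-cocoercive (dual_op_cocoercive).
    With the bound on gamma_n, cocoercivity makes the squared W_n-distance from
    v_n to any dual solution decrease, up to summable perturbations, by a fixed
    multiple of |v_n - q_n|^2 + |C v_n - C vbar|^2, where q_n is the resolvent
    computed without errors (fb_lyapunov).  Hence that distance converges, and
    both residuals tend to 0 (fb_fejer).

    The bounded sequence v_n has a weak limit along every ultrafilter
    (ultra_weak_limit).  Each such limit is a dual solution, because the graph
    of a maximally monotone operator is closed for weak times strong
    convergence (fb_cluster).  Two such limits agree, because the distances to
    both converge and W_n converges pointwise (metric_limit, fb_cluster_uniq).
    So v_n converges weakly to one dual solution vbar.  The sum of the products
    <v_n - vbar | C v_n - C vbar> then tends to 0, and the displayed inequality
    turns this into the strong convergence of x(v_n).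

    The existence statements behind this all come from one minimisation lemma
    (argmin_half_sqnorm): a closed convex function plus half the squared norm
    attains its minimum.  Applied to a linear form it is the Riesz theorem, and
    it provides adjoints.  Applied to the Fitzpatrick function of an operator it
    is the theorem of Minty.  With the Banach fixed point theorem, the latter
    solves w in T u + M u for T Lipschitz and strongly monotone
    (max_monotone_add_surj); the resolvents, the functions D_i^-1 and the
    inverses U_n^-1 are all instances.

    The direct sum of the spaces G_i is never formed: its scalar product appears
    as a sum over i. *)

(** * Scalar products and positive forms *)

Section InnerProduct.
Context {R : realType} {H : hilbertType R}.
Implicit Types x y z : H.

Lemma dotpC x y : '<| x, y |> = '<| y, x |>.
Proof. by rewrite hermC expr0 mul1r. Qed.
Lemma dotpDl x y z : '<| x + y, z |> = '<| x, z |> + '<| y, z |>.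
Proof. exact: linearDl. Qed.
Lemma dotpDr x y z : '<| z, x + y |> = '<| z, x |> + '<| z, y |>.
Proof. exact: linearDr. Qed.
Lemma dotpNl x y : '<| - x, y |> = - '<| x, y |>.
Proof. exact: linearNl. Qed.
Lemma dotpNr x y : '<| y, - x |> = - '<| y, x |>.
Proof. exact: linearNr. Qed.
Lemma dotpZl (k : R) x y : '<| k *: x, y |> = k * '<| x, y |>.
Proof. by rewrite linearZl_LR. Qed.
Lemma dotpZr (k : R) x y : '<| y, k *: x |> = k * '<| y, x |>.
Proof. by rewrite linearZr_LR. Qed.
Lemma dotp0l x : '<| 0, x |> = 0.
Proof. exact: linear0l. Qed.
Lemma dotp0r x : '<| x, 0 |> = 0.
Proof. exact: linear0r. Qed.

Definition dotpE := (dotpDl, dotpDr, dotpNl, dotpNr, dotpZl, dotpZr).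

Lemma dotp_suml (I : finType) (F : I -> H) y :
  '<| \sum_i F i, y |> = \sum_i '<| F i, y |>.
Proof. by rewrite linear_sumlz. Qed.

(** Testing against all vectors reduces an identity between vectors to one
    between scalars, which [ring] proves after expansion by [dotpE]. *)
Lemma dotp_inj x y : (forall z, '<| x, z |> = '<| y, z |>) -> x = y.
Proof.
move=> e; apply/eqP; rewrite -subr_eq0 -normr_eq0 -sqrf_eq0 -dotp_norm.
by rewrite dotpDl dotpNl e subrr.
Qed.

Lemma sub_sqnorm_le0 x y : `|x - y| ^+ 2 <= 0 -> x = y.
Proof.
move=> h; apply/eqP; rewrite -subr_eq0 -normr_eq0 -sqrf_eq0.
by apply/eqP/le_anti; rewrite h sqr_ge0.
Qed.

(** The polynomial t |-> <T (x + t y) | x + t y> is nonnegative.  If its leading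
    coefficient <T y | y> vanishes it is affine, hence constant; otherwise its
    value at the vertex is the claim. *)
Lemma psd_CS (T : {linear H -> H}) : self_adjoint T ->
  (forall x, 0 <= '<| T x, x |>) ->
  forall x y, '<| T x, y |> ^+ 2 <= '<| T x, x |> * '<| T y, y |>.
Proof.
move=> sT pT x y.
have q (t : R) : 0 <= '<| T x, x |> + 2 * t * '<| T x, y |> + t ^+ 2 * '<| T y, y |>.
  have := pT (x + t *: y); rewrite (linearD T) (linearZ_LR T) !dotpE (sT y x) (dotpC y).
  congr (_ <= _); ring.
have [c0|c0] := eqVneq '<| T y, y |> 0.
  rewrite c0 mulr0; have [->|b0] := eqVneq '<| T x, y |> 0; first by rewrite expr0n.
  have := q (- ('<| T x, x |> + 1) / (2 * '<| T x, y |>)).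
  rewrite c0 mulr0 addr0.
  have -> : 2 * (- ('<| T x, x |> + 1) / (2 * '<| T x, y |>)) * '<| T x, y |>
     = - ('<| T x, x |> + 1) by field.
  lra.
have cp : 0 < '<| T y, y |> by rewrite lt0r c0 pT.
have := q (- '<| T x, y |> / '<| T y, y |>).
set b := '<| T x, y |>; set c := '<| T y, y |> in c0 cp *; set a := '<| T x, x |>.
have -> : a + 2 * (- b / c) * b + (- b / c) ^+ 2 * c = (a * c - b ^+ 2) / c by field.
by rewrite pmulr_lge0 ?invr_gt0// subr_ge0.
Qed.

Lemma dotp_le x y : `|'<| x, y |>| <= `|x| * `|y|.
Proof.
rewrite -(@ler_pXn2r _ 2) ?nnegrE ?mulr_ge0// real_normK ?num_real// exprMn.
rewrite -!dotp_norm; apply: (@psd_CS idfun) => // z /=.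
by rewrite dotp_norm sqr_ge0.
Qed.

Lemma dotp_ler x y : '<| x, y |> <= `|x| * `|y|.
Proof. exact: le_trans (ler_norm _) (dotp_le _ _). Qed.

(** Cauchy-Schwarz for the form of T, applied to x and T x. *)
Lemma psd_bounded_sq (T : {linear H -> H}) (M : R) : self_adjoint T ->
  (forall x, 0 <= '<| T x, x |>) -> 0 <= M -> (forall x, `|T x| <= M * `|x|) ->
  forall x, `|T x| ^+ 2 <= M * '<| T x, x |>.
Proof.
move=> sT pT M0 bT x; have := psd_CS sT pT x (T x).
have [->|n0] := eqVneq (T x) 0.
  by move=> _; rewrite normr0 expr0n /= dotp0l mulr0.
have np : 0 < `|T x| ^+ 2 by rewrite exprn_gt0 ?normr_gt0.
rewrite dotp_norm expr2 => h.
rewrite -(ler_pM2r np); apply: (le_trans h).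
rewrite mulrC mulrAC; apply: ler_wpM2r => //; apply: (le_trans (dotp_ler _ _)).
by rewrite expr2 mulrA; apply: ler_wpM2r.
Qed.

(** Polarisation expresses the scalar product by norms. *)
Lemma dotp_cvg {T : Type} (F : set_system T) {FF : Filter F} (f g : T -> H) x y :
  f @ F --> x -> g @ F --> y ->
  (fun t => '<| f t, g t |>) @ F --> '<| x, y |>.
Proof.
move=> fx gy.
have e t : '<| f t, g t |> = 4^-1 * (`|f t + g t| ^+ 2 - `|f t - g t| ^+ 2).
  by rewrite -!dotp_norm !dotpE (dotpC (g t)); field.
have e' : '<| x, y |> = 4^-1 * (`|x + y| ^+ 2 - `|x - y| ^+ 2).
  by rewrite -!dotp_norm !dotpE (dotpC y); field.
rewrite e' (_ : (fun _ => _) = fun t => 4^-1 * (`|f t + g t| ^+ 2 - `|f t - g t| ^+ 2)).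
  apply: cvgMr; apply: cvgB; rewrite expr2; apply: cvgM; apply: cvg_norm.
  - exact: cvgD.
  - exact: cvgD.
  - exact: cvgB.
  - exact: cvgB.
by apply/funext.
Qed.

End InnerProduct.

(** * Real sequences *)

Section Summable.
Context {R : realType}.
Implicit Types u v : nat -> R.

Definition nnsummable u := (forall n, 0 <= u n) /\ cvgn (series u).

Lemma nnsummable_le u v : (forall n, 0 <= u n <= v n) -> nnsummable v -> nnsummable u.
Proof.
move=> uv [v0 cv]; split=> [n|]; first by case/andP: (uv n).
by apply: (series_le_cvg _ v0 _ cv) => n; case/andP: (uv n).
Qed.

Lemma nnsummableD u v : nnsummable u -> nnsummable v -> nnsummable (fun n => u n + v n).
Proof.
by move=> [u0 cu] [v0 cv]; split=> [n|]; [exact: addr_ge0 | exact: is_cvg_seriesD].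
Qed.

Lemma nnsummableZ (k : R) u : 0 <= k -> nnsummable u -> nnsummable (fun n => k * u n).
Proof.
by move=> k0 [u0 cu]; split=> [n|]; [exact: mulr_ge0 | exact: is_cvg_seriesZ].
Qed.

Lemma nnsummableM u v : nnsummable u -> nnsummable v -> nnsummable (fun n => u n * v n).
Proof.
move=> [u0 cu] sv.
have [K uK] : exists K, forall n, u n <= K.
  exists (limn (series u)) => n; apply: (@le_trans _ _ (series u n.+1)).
    by rewrite /series /= big_nat_recr//= lerDr sumr_ge0.
  apply: nondecreasing_cvgn_le => //.
  by apply/nondecreasing_seqP => k; rewrite /series /= big_nat_recr//= lerDl.
apply: (@nnsummable_le _ (fun n => K * v n)).
  by move=> n; rewrite mulr_ge0 ?sv.1//= ler_wpM2r ?sv.1.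
by apply: nnsummableZ => //; apply: le_trans (uK 0).
Qed.

Lemma nnsummable_sum (I : finType) (f : I -> nat -> R) :
  (forall i, nnsummable (f i)) -> nnsummable (fun n => \sum_i f i n).
Proof.
move=> sf; elim: (index_enum I) => [|i s IH].
  have -> : (fun n => \sum_(i <- [::]) f i n) = fun=> 0.
    by apply/funext => n; rewrite big_nil.
  split=> //; have -> : series (fun=> 0 : R) = fun=> 0.
    by apply/funext => n; rewrite /series /= big1.
  exact: is_cvg_cst.
have -> : (fun n => \sum_(j <- i :: s) f j n) = fun n => f i n + \sum_(j <- s) f j n.
  by apply/funext => n; rewrite big_cons.
exact: nnsummableD.
Qed.

End Summable.

Section RealSequences.
Context {R : realType}.
Implicit Types a t al be : nat -> R.

Lemma prod1D_ge1 al n : (forall n, 0 <= al n) -> 1 <= \prod_(k < n) (1 + al k).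
Proof.
move=> al0; elim/big_ind: _ => // [x y x1 y1|i _]; last by rewrite lerDl.
by rewrite -[1]mulr1 ler_pM.
Qed.

Let Pi al n := \prod_(k < n) (1 + al k).
Let Pi_ge1 := prod1D_ge1.

(** The products increase, and 1 + x <= exp x bounds them by the exponential of
    the sum of the series. *)
Lemma cvg_prod1D al : (forall n, 0 <= al n) -> cvgn (series al) ->
  exists2 p : R, 1 <= p & Pi al @ \oo --> p.
Proof.
move=> al0 cal.
have Pi_nd : {homo Pi al : n m / (n <= m)%N >-> n <= m}.
  apply/nondecreasing_seqP => n; rewrite /Pi big_ord_recr /=.
  by rewrite ler_peMr ?lerDl//; apply: le_trans (Pi_ge1 n al0).
have : cvgn (Pi al).
  apply: nondecreasing_is_cvgn => //.
  exists (expR (limn (series al))) => _ [n _ <-].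
  apply: (@le_trans _ _ (expR (series al n))).
    rewrite /series /= big_mkord; elim: n => [|n IH].
      by rewrite /Pi !big_ord0 expR0.
    rewrite /Pi !big_ord_recr /= expRD; apply: ler_pM => //.
    - by apply: le_trans (Pi_ge1 n al0).
    - by rewrite addr_ge0.
    - exact: expR_ge1Dx.
  rewrite ler_expR; apply: nondecreasing_cvgn_le => //.
  by apply/nondecreasing_seqP => m; rewrite /series /= big_nat_recr//= lerDl.
move=> /cvg_ex[p pP]; exists p => //.
rewrite -(cvg_lim _ pP)//; apply: limr_ge; first by apply/cvg_ex; exists p.
by apply: nearW => n; exact: Pi_ge1.
Qed.

(** Dividing by the products of the 1 + al k absorbs the factors: the quotient
    minus the partial sums of be is nonincreasing.  Once a converges, the
    recursion bounds t by a sequence that tends to 0. *)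
Lemma quasi_fejer_cvg a t al be :
  (forall n, 0 <= a n) -> (forall n, 0 <= t n) ->
  (forall n, 0 <= al n) -> (forall n, 0 <= be n) ->
  cvgn (series al) -> cvgn (series be) ->
  (forall n, a n.+1 <= (1 + al n) * a n - t n + be n) ->
  cvgn a /\ t @ \oo --> 0.
Proof.
move=> a0 t0 al0 be0 cal cbe rec.
have [p p1 Pp] := cvg_prod1D al0 cal.
have P0 n : 0 < Pi al n by apply: lt_le_trans (Pi_ge1 n al0).
have PS n : Pi al n.+1 = Pi al n * (1 + al n) by rewrite /Pi big_ord_recr.
pose d n := a n / Pi al n - series be n.
have nd : {homo d : n m / (n <= m)%N >-> m <= n}.
  apply/nonincreasing_seqP => n; rewrite /d /series /= big_nat_recr//= PS.
  rewrite opprD [- _ - _]addrC addrA; apply: lerD => //.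
  have al1 : 0 < 1 + al n by rewrite ltr_pwDl.
  rewrite lerBlDr ler_pdivrMr ?mulr_gt0//.
  rewrite mulrDl mulrA divfK ?gt_eqF//.
  apply: (le_trans (rec n)); rewrite [a n * _]mulrC; apply: lerD.
    by rewrite gerBl.
  rewrite -PS; apply: ler_peMr => //; exact: Pi_ge1.
have cd : cvgn d.
  apply: nonincreasing_is_cvgn => //.
  exists (- limn (series be)) => _ [n _ <-]; rewrite /d.
  rewrite ler_wpDl ?divr_ge0 ?(ltW (P0 _))//.
  rewrite lerN2; apply: nondecreasing_cvgn_le => //.
  by apply/nondecreasing_seqP => m; rewrite /series /= big_nat_recr//= lerDl.
have ca : cvgn a.
  have -> : a = (fun n => (d n + series be n) * Pi al n).
    by apply/funext => n; rewrite /d subrK divfK ?gt_eqF.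
  apply: is_cvgM; last by apply/cvg_ex; exists p.
  exact: is_cvgD.
split=> //; have /cvg_ex[l la] := ca.
apply: (@squeeze_cvgr _ _ _ _ (fun=> 0) (fun n => (1 + al n) * a n - a n.+1 + be n)).
- apply: nearW => n; rewrite t0 /=; have := rec n; lra.
- exact: cvg_cst.
- have -> : (0 : R) = (1 + 0) * l - l + 0 by ring.
  apply: cvgD; last exact: cvg_series_cvg_0.
  apply: cvgB; last by rewrite (cvg_shiftS a).
  apply: cvgM => //; apply: cvgD; first exact: cvg_cst.
  exact: cvg_series_cvg_0.
Qed.

End RealSequences.

(** * Convergence *)

Lemma cauchy_sq_cvg (R : realType) (V : completeNormedModType R) (u : nat -> V)
  (c : nat -> R) : c @ \oo --> 0 ->
  (forall n k, `|u n - u k| ^+ 2 <= c n + c k) -> cvgn u.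
Proof.
move=> c0 uc; apply/cauchy_cvgP/cauchy_ballP => e e0; near_simpl.
have e2 : 0 < e ^+ 2 / 2 by rewrite divr_gt0 ?exprn_gt0.
have cs : \forall n \near \oo, `|c n| < e ^+ 2 / 2.
  by move/cvgr0Pnorm_lt : c0; exact.
near=> n; rewrite -ball_normE /=.
rewrite -(@ltr_pXn2r _ 2) ?nnegrE ?(ltW e0)//.
apply: (le_lt_trans (uc _ _)).
have h1 : `|c n.1| < e ^+ 2 / 2.
  by near: n; exact: (cvg_fst cs).
have h2 : `|c n.2| < e ^+ 2 / 2.
  by near: n; exact: (cvg_snd cs).
have := ler_norm (c n.1); have := ler_norm (c n.2); lra.
Unshelve. all: by end_near. Qed.

Lemma sq_le_cvg0 (R : realType) (V : normedModType R) (f : nat -> V) (t : nat -> R) :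
  (forall n, `|f n| ^+ 2 <= t n) -> t @ \oo --> 0 -> f @ \oo --> 0.
Proof.
move=> ft /cvgr0Pnorm_lt t0; apply/cvgr0Pnorm_lt => e e0.
have [N _ tN] := t0 (e ^+ 2) (exprn_gt0 _ e0).
exists N => // n /= Nn; rewrite -(@ltr_pXn2r _ 2) ?nnegrE ?(ltW e0)//.
by apply: le_lt_trans (ft n) _; apply: le_lt_trans (ler_norm _) (tN n Nn).
Qed.

Lemma cvg_sum_fin (R : realType) (I : finType) (F : set_system nat) {FF : Filter F}
    (f : I -> nat -> R) (l : I -> R) :
  (forall i, f i @ F --> l i) -> (fun n => \sum_i f i n) @ F --> \sum_i l i.
Proof. by move=> fl; apply: cvg_big => //; exact: add_continuous. Qed.

(** * Minimisation, Riesz representation and adjoints *)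

(** P is the epigraph of a closed convex function f of two variables, which may
    take the value infinity; two variables are what the theorem of Minty needs.
    By the parallelogram identity a minimising sequence of f plus half the
    squared norm is Cauchy.  The conclusion is the first-order condition
    f p' >= f p - <p | p' - p> at the minimiser p = (x, y). *)
Section Argmin.
Context {R : realType} {H G : hilbertType R}.
Variables (P : H -> G -> R -> Prop) (lo : R).
Hypothesis P_ex : exists x y s, P x y s.
Hypothesis P_lo : forall x y s, P x y s -> lo <= s + 2^-1 * (`|x| ^+ 2 + `|y| ^+ 2).
Hypothesis P_convex : forall x y s x' y' s' (t : R), 0 <= t <= 1 ->
  P x y s -> P x' y' s' ->
  P (x + t *: (x' - x)) (y + t *: (y' - y)) (s + t * (s' - s)).
Hypothesis P_closed : forall x_ y_ (s_ : nat -> R) x y (s : R),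
  (forall n : nat, P (x_ n) (y_ n) (s_ n)) ->
  x_ @ \oo --> x -> y_ @ \oo --> y -> s_ @ \oo --> s -> P x y s.

Let val (x : H) (y : G) (s : R) : R := s + 2^-1 * (`|x| ^+ 2 + `|y| ^+ 2).
Let S := [set c | exists x y s, P x y s /\ c = val x y s].

Let S_inf : has_inf S.
Proof.
split; first by case: P_ex => x [y [s p]]; exists (val x y s); exists x, y, s.
by exists lo => _ [x [y [s [p ->]]]]; exact: P_lo.
Qed.

Let inf_le x y s : P x y s -> inf S <= val x y s.
Proof. by move=> p; apply: ge_inf; [case: S_inf | exists x, y, s]. Qed.

Let parallelogram x y s x' y' s' : P x y s -> P x' y' s' ->
  `|x - x'| ^+ 2 + `|y - y'| ^+ 2 <=
  4 * ((val x y s - inf S) + (val x' y' s' - inf S)).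
Proof.
move=> p p'.
have h : 0 <= (2^-1 : R) <= 1 by lra.
have := inf_le (P_convex h p p'); rewrite /val -!dotp_norm !dotpE.
rewrite (dotpC x') (dotpC y'); lra.
Qed.

Lemma argmin_half_sqnorm : exists x y s, P x y s /\
  forall x' y' s', P x' y' s' ->
    s <= s' + '<| x, x' - x |> + '<| y, y' - y |>.
Proof.
have Q (n : nat) : exists q : H * G * R, P q.1.1 q.1.2 q.2 /\
    val q.1.1 q.1.2 q.2 - inf S < harmonic n.
  have [_ [x [y [s [p ->]]]] h] := inf_adherent (harmonic_gt0 n) S_inf.
  by exists (x, y, s); split => //=; rewrite ltrBlDl.
have [q qP] := choice Q.
have c0 : (fun n => 4 * harmonic n) @ \oo --> (0 : R).
  by rewrite -[X in _ --> X](mulr0 4); apply: cvgMl_tmp; exact: cvg_harmonic.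
have qc n k : `|(q n).1.1 - (q k).1.1| ^+ 2 + `|(q n).1.2 - (q k).1.2| ^+ 2 <=
    4 * harmonic n + 4 * harmonic k.
  have h := parallelogram (qP n).1 (qP k).1; have [_ hn] := qP n; have [_ hk] := qP k.
  apply: (le_trans h); rewrite -mulrDr; apply: ler_wpM2l; first by [].
  by apply: lerD; exact: ltW.
have /cvg_ex[x xP] : cvgn (fun n => (q n).1.1).
  apply: (cauchy_sq_cvg c0) => n k; apply: le_trans (qc n k).
  by rewrite lerDl sqr_ge0.
have /cvg_ex[y yP] : cvgn (fun n => (q n).1.2).
  apply: (cauchy_sq_cvg c0) => n k; apply: le_trans (qc n k).
  by rewrite lerDr sqr_ge0.
have vP : (fun n => val (q n).1.1 (q n).1.2 (q n).2) @ \oo --> inf S.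
  apply: (@squeeze_cvgr _ _ _ _ (fun=> inf S) (fun n => inf S + harmonic n)).
  - near=> n; rewrite inf_le /=; last exact: (qP n).1.
    by rewrite -lerBlDl ltW//; case: (qP n).
  - exact: cvg_cst.
  - rewrite -[X in _ --> X]addr0; apply: cvgD; first exact: cvg_cst.
    exact: cvg_harmonic.
pose s := inf S - 2^-1 * (`|x| ^+ 2 + `|y| ^+ 2).
have sP : (fun n => (q n).2) @ \oo --> s.
  rewrite (_ : (fun _ => _) = fun n => val (q n).1.1 (q n).1.2 (q n).2 -
    2^-1 * (`|(q n).1.1| ^+ 2 + `|(q n).1.2| ^+ 2)); last first.
    by apply/funext => n; rewrite /val addrK.
  apply: cvgB => //; apply: cvgMl_tmp; rewrite !expr2; apply: cvgD; apply: cvgM; exact: cvg_norm.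
have Ps : P x y s by apply: P_closed xP yP sP => n; exact: (qP n).1.
exists x, y, s; split => // x' y' s' Ps'; rewrite leNgt; apply/negP => lt.
(* Moving from p to p + t (p' - p) gains t de to first order and loses t^2 N to
   second order; for t = de / (de + N) the gain wins. *)
pose N := 2^-1 * (`|x' - x| ^+ 2 + `|y' - y| ^+ 2).
have N0 : 0 <= N by rewrite mulr_ge0 ?addr_ge0 ?sqr_ge0 ?invr_ge0.
pose de := s - (s' + '<| x, x' - x |> + '<| y, y' - y |>).
have d0 : 0 < de by rewrite subr_gt0.
have dN : 0 < de + N by rewrite ltr_wpDr.
pose t := de / (de + N).
have t0 : 0 < t by rewrite divr_gt0.
have t1 : 0 <= t <= 1 by rewrite ltW//= ler_pdivrMr// mul1r lerDl.
have := inf_le (P_convex t1 Ps Ps'); rewrite /val.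
have -> : inf S = s + 2^-1 * (`|x| ^+ 2 + `|y| ^+ 2) by rewrite /s subrK.
have -> : `|x + t *: (x' - x)| ^+ 2 =
  `|x| ^+ 2 + 2 * t * '<| x, x' - x |> + t ^+ 2 * `|x' - x| ^+ 2.
  rewrite -!dotp_norm; move: (x' - x) => w; rewrite !dotpE (dotpC w); ring.
have -> : `|y + t *: (y' - y)| ^+ 2 =
  `|y| ^+ 2 + 2 * t * '<| y, y' - y |> + t ^+ 2 * `|y' - y| ^+ 2.
  rewrite -!dotp_norm; move: (y' - y) => w; rewrite !dotpE (dotpC w); ring.
have tN : t * de = t * (t * (de + N)) by rewrite /t divfK// gt_eqF.
have tt : 0 < t * (t * de) by rewrite mulr_gt0// mulr_gt0.
have NE : t * (t * N) = t * (t * (2^-1 * (`|x' - x| ^+ 2 + `|y' - y| ^+ 2))) by [].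
have dE : t * de = t * (s - (s' + '<| x, x' - x |> + '<| y, y' - y |>)) by [].
move: tt tN NE dE; clearbody t de N => tt tN NE dE h; lra.
Unshelve. all: by end_near. Qed.

End Argmin.

Section Riesz.
Context {R : realType} {H : hilbertType R}.

(** Minimise |x|^2 / 2 - l x, the second variable being kept at 0: the first-order
    condition reads l h <= <u | h> for all h, hence equality. *)
Lemma riesz (l : H -> R) (M : R) :
  (forall k x y, l (k *: x + y) = k * l x + l y) ->
  (forall x, `|l x| <= M * `|x|) ->
  exists u, forall x, l x = '<| x, u |>.
Proof.
move=> ll lM.
have l0 : l 0 = 0 by have := ll 1 0 0; rewrite scale1r addr0; lra.
have lN x : l (- x) = - l x.
  by have := ll (-1) x 0; rewrite scaleN1r addr0 l0; lra.
have lB x y : l (x - y) = l x - l y.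
  by have := ll 1 x (- y); rewrite scale1r lN mul1r.
pose P (x y : H) (s : R) := y = 0 /\ s = - l x.
have [||||u [y [s [[y0 sE] us]]]] := @argmin_half_sqnorm R H H P (- (2^-1 * M ^+ 2)).
- by exists 0, 0, (- l 0).
- move=> x y s [-> ->]; rewrite normr0 expr0n addr0.
  have h1 := ler_norm (l x); have h2 := lM x; have := sqr_ge0 (`|x| - M); nra.
- move=> x y s x' y' s' t _ [-> ->] [-> ->]; split; first by rewrite subrr scaler0 addr0.
  by rewrite (addrC x) ll lB; ring.
- move=> x_ y_ s_ x y s xys xx yy ss; split.
    have yE : y_ = fun=> 0 by apply/funext => n; case: (xys n).
    by apply: (@cvg_unique _ _ (y_ @ \oo)) => //; rewrite yE; exact: cvg_cst.
  apply: (@cvg_unique _ _ (s_ @ \oo)) => //.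
  have -> : s_ = fun n => - l (x_ n) by apply/funext => n; case: (xys n).
  apply: cvgN; apply/subr_cvg0.
  apply: norm_cvg0.
  apply: (@squeeze_cvgr _ _ _ _ (fun=> 0) (fun n => M * `|x_ n - x|)).
  + by near=> n; rewrite normr_ge0 /= -lB lM.
  + exact: cvg_cst.
  + rewrite -[X in _ --> X](mulr0 M); apply: cvgMl_tmp.
    rewrite -(@normr0 _ H); apply: cvg_norm; rewrite -(subrr x).
    apply: cvgB => //; exact: cvg_cst.
exists u => x.
have h (z : H) : l z <= '<| u, z |>.
  have := us (u + z) 0 (- l (u + z)) (conj erefl erefl).
  have -> : u + z - u = z by rewrite addrC addKr.
  have := ll 1 u z; rewrite scale1r sE y0 dotp0l; lra.
rewrite dotpC; have := h x; have := h (- x); rewrite lN dotpNr; lra.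
Unshelve. all: by end_near. Qed.

End Riesz.

Section Adjoint.
Context {R : realType} {H G : hilbertType R} (L : {linear H -> G}).
Hypothesis L_bounded : bounded_near L (nbhs (0 : H)).

Let S := [set `|L x| | x in [set x : H | `|x| <= 1]].
Let S_sup : has_sup S.
Proof.
have /linear_boundedP/pinfty_ex_gt0[M M0 LM] := L_bounded.
split; first by exists `|L 0|, 0 => //=; rewrite normr0.
exists M => _ [x /= x1 <-]; apply: le_trans (LM x) _.
by rewrite ler_piMr// ltW.
Qed.

Lemma opnorm_ge0 : 0 <= opnorm L.
Proof.
apply: (sup_upper_bound S_sup).
by exists 0; rewrite /= ?linear0 normr0.
Qed.

Lemma opnorm_le x : `|L x| <= opnorm L * `|x|.
Proof.
have [->|x0] := eqVneq x 0; first by rewrite linear0 !normr0 mulr0.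
have nx : 0 < `|x| by rewrite normr_gt0.
rewrite -ler_pdivrMr//; apply: (sup_upper_bound S_sup).
exists (`|x|^-1 *: x); first by rewrite /= normrZ ger0_norm ?invr_ge0// mulVf ?gt_eqF.
by rewrite linearZ normrZ ger0_norm ?invr_ge0// mulrC.
Qed.

Lemma adjointP x y : '<| L x, y |> = '<| x, adjoint L y |>.
Proof.
suff : exists u, [set u | forall x, '<| L x, y |> = '<| x, u |>] u.
  by move=> /(xgetPex 0) /=; exact.
apply: (@riesz _ _ _ (opnorm L * `|y|)) => [k a b|a].
  by rewrite linearP dotpDl dotpZl.
rewrite mulrAC; apply: le_trans (dotp_le _ _) _.
by apply: ler_wpM2r => //; exact: opnorm_le.
Qed.

Lemma adjointB y y' : adjoint L (y - y') = adjoint L y - adjoint L y'.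
Proof.
apply: dotp_inj => x; rewrite dotpC -adjointP !dotpE.
by rewrite !adjointP !(dotpC x).
Qed.

End Adjoint.

(** * Maximally monotone operators *)

Section MaximalMonotone.
Context {R : realType} {H : hilbertType R}.
Implicit Types M : H -> set H.

Lemma max_monotoneP M : max_monotone M <-> monotone_op M /\
  forall x u, (forall y v, M y v -> 0 <= '<| x - y, u - v |>) -> M x u.
Proof.
split=> -[mM maxM]; split => //.
  move=> x u xu; apply: contrapT => nM.
  pose M' : H -> set H := fun y v => M y v \/ (y = x /\ v = u).
  apply: (maxM M').
    move=> y y' v v' [My|[-> ->]] [My'|[-> ->]].
    - exact: mM.
    - by rewrite -opprB -(opprB u) dotpNl dotpNr opprK; exact: xu.
    - exact: xu.
    - by rewrite subrr dotp0l.
  split; first by move=> [y v]; left.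
  by move=> /(_ (x, u)); apply: contra_not nM; apply; right.
move=> M' mM' [sub nsub]; apply: nsub => -[x u] /= M'x.
by apply: maxM => y v My; apply: mM' => //; exact: (sub (y, v)).
Qed.

(** P is the epigraph of the Fitzpatrick function F of M - w.  Maximality gives
    F (x, u) >= <x | u>, so F plus half the squared norm is at least
    |x + u|^2 / 2.  At the minimiser (x, u), the first-order condition tested on
    the graph shows that (- u, - x) is monotonically related to that graph,
    hence belongs to it; testing on this very point gives x + u = 0. *)
Lemma minty M : max_monotone M -> forall w, exists x, M x (w - x).
Proof.
move=> /max_monotoneP[mM maxM] w.
pose P (x u : H) (s : R) := forall y v, M y v ->
  '<| x, v - w |> + '<| u, y |> - '<| y, v - w |> <= s.
have [y0 [v0 M0]] : exists y v, M y v.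
  apply: contrapT => nM; apply: (nM); exists 0, 0; apply: maxM => y v My.
  by case: nM; exists y, v.
have P_ge x u s : P x u s -> '<| x, u |> <= s.
  move=> p; rewrite leNgt; apply/negP => lt.
  have Mxu : M x (u + w).
    apply: maxM => y v My; have := p y v My.
    rewrite !dotpE (dotpC y u); move: lt; lra.
  by have := p _ _ Mxu; rewrite addrK (dotpC u); move: lt; lra.
have [||||x [u [s [p xus]]]] := @argmin_half_sqnorm R H H P 0.
- exists y0, (v0 - w), '<| y0, v0 - w |> => y v My.
  have := mM _ _ _ _ M0 My; rewrite !dotpE (dotpC w y) (dotpC v0 y); lra.
- move=> x u s /P_ge ps.
  have : 0 <= '<| x + u, x + u |> by rewrite dotp_norm sqr_ge0.
  rewrite -!dotp_norm !dotpE (dotpC u x); lra.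
- move=> x u s x' u' s' t /andP[t0 t1] p p' y v My.
  have := p _ _ My; have := p' _ _ My; rewrite !dotpE => h' h.
  have := ler_wpM2l t0 h'.
  have t1' : 0 <= 1 - t by rewrite subr_ge0.
  have := ler_wpM2l t1' h; lra.
- move=> x_ u_ s_ x u s p xx uu ss y v My.
  apply: (ler_cvg_to (f := fun n => '<| x_ n, v - w |> + '<| u_ n, y |> - '<| y, v - w |>) (g := s_) _ ss).
    by apply: cvgB; [apply: cvgD; apply: dotp_cvg => //|]; exact: cvg_cst.
  by apply: nearW => n; exact: p.
have sxu := P_ge _ _ _ p.
have sq : 0 <= '<| x + u, x + u |> by rewrite dotp_norm sqr_ge0.
have key y v : M y v -> 2^-1 * '<| x + u, x + u |> <= '<| y + u, v - w + x |>.
  move=> My.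
  have Py : P y (v - w) '<| y, v - w |>.
    move=> y' v' My'; have := mM _ _ _ _ My My'.
    rewrite !dotpE (dotpC w y') (dotpC v y'); lra.
  have := xus _ _ _ Py; move: sxu sq.
  rewrite !dotpE (dotpC u x) (dotpC y x); lra.
have Mu : M (- u) (w - x).
  apply: maxM => y v My; have := key _ _ My.
  have -> : '<| - u - y, w - x - v |> = '<| y + u, v - w + x |>.
    by rewrite !dotpE; ring.
  lra.
have : '<| x + u, x + u |> = 0.
  have := key _ _ Mu; rewrite addNr dotp0l; lra.
move=> /eqP; rewrite dotp_norm sqrf_eq0 normr_eq0 addr_eq0 => /eqP xE.
by exists x; rewrite {1}xE.
Qed.

Lemma max_monotone_scale M (t : R) : 0 < t -> max_monotone M ->
  max_monotone (fun x => [set u | M x (t^-1 *: u)]).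
Proof.
move=> t0 /max_monotoneP[mM maxM]; apply/max_monotoneP; split.
  move=> x y u v Mx My; have := mM _ _ _ _ Mx My.
  by rewrite -scalerBr dotpZr pmulr_rge0 ?invr_gt0.
move=> x u h; apply: maxM => y v My; have := h y (t *: v).
rewrite /= scalerA mulVf ?gt_eqF// scale1r => /(_ My).
have -> : u - t *: v = t *: (t^-1 *: u - v).
  by rewrite scalerBr scalerA divff ?gt_eqF// scale1r.
by rewrite dotpZr pmulr_rge0.
Qed.

(** The solutions are the fixed points of u |-> J_(t M) (u - t T u + t w), which
    is a contraction when t is small. *)
Lemma max_monotone_add_surj M (T : H -> H) (c K : R) : max_monotone M ->
  0 < c -> (forall x y, c * `|x - y| ^+ 2 <= '<| x - y, T x - T y |>) ->
  0 <= K -> (forall x y, `|T x - T y| <= K * `|x - y|) ->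
  forall w, exists u, M u (w - T u).
Proof.
move=> maxM c0 Tc K0 TK w.
have KK : 0 < K + c by rewrite ltr_wpDl.
(* Dividing by K + c instead of K makes 1 - t c, the square of the contraction
   factor, nonnegative without comparing c and K. *)
pose t := c / (K + c) ^+ 2.
have t0 : 0 < t by rewrite divr_gt0 ?exprn_gt0.
pose q2 := 1 - t * c.
have tc : t * c <= 1.
  rewrite /t mulrAC -expr2 ler_pdivrMr ?exprn_gt0// mul1r.
  by rewrite ler_pXn2r ?nnegrE ?(ltW c0) ?(ltW KK)// lerDr.
have q20 : 0 <= q2 by rewrite subr_ge0.
have q21 : q2 < 1 by rewrite ltrBlDr ltrDl mulr_gt0.
have /choice[phi phiP] : forall u, exists x,
    M x (t^-1 *: (u - t *: T u + t *: w - x)).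
  by move=> u; exact: (minty (max_monotone_scale t0 maxM)).
have mM := maxM.1.
have lip u v : `|phi u - phi v| <= Num.sqrt q2 * `|u - v|.
  have := mM _ _ _ _ (phiP u) (phiP v).
  rewrite -scalerBr dotpZr pmulr_rge0 ?invr_gt0// => h.
  pose d := (u - v) - t *: (T u - T v).
  have h1 : `|phi u - phi v| <= `|d|.
    have : '<| phi u - phi v, phi u - phi v |> <= '<| phi u - phi v, d |>.
      by move: h; rewrite /d !dotpE; lra.
    rewrite dotp_norm => h2; have := le_trans h2 (dotp_ler _ _).
    have [->|n0] := eqVneq `|phi u - phi v| 0; first by [].
    by rewrite expr2 ler_pM2l// lt0r n0 /=.
  apply: (le_trans h1).
  rewrite -(@ler_pXn2r _ 2) ?nnegrE ?mulr_ge0 ?sqrtr_ge0// exprMn sqr_sqrtr//.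
  have hT : `|T u - T v| ^+ 2 <= K ^+ 2 * `|u - v| ^+ 2.
    by rewrite -exprMn ler_pXn2r ?nnegrE ?mulr_ge0//; exact: TK.
  have hc := Tc u v.
  have -> : `|d| ^+ 2 = `|u - v| ^+ 2 - 2 * t * '<| u - v, T u - T v |>
      + t ^+ 2 * `|T u - T v| ^+ 2.
    rewrite -!dotp_norm /d; move: (u - v) (T u - T v) => a b.
    by rewrite !dotpE (dotpC b); ring.
  have tK : t ^+ 2 * K ^+ 2 <= t * c.
    rewrite expr2 -mulrA; apply: ler_wpM2l; first exact: ltW.
    rewrite /t mulrAC ler_pdivrMr ?exprn_gt0//; apply: ler_wpM2l; first exact: ltW.
    by rewrite ler_pXn2r ?nnegrE ?(ltW KK)// lerDl ltW.
  have h3 := ler_wpM2l (sqr_ge0 t) hT.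
  have h4 := ler_wpM2r (sqr_ge0 `|u - v|) tK.
  have h5 := ler_wpM2l (ltW t0) hc.
  rewrite /q2; lra.
pose f : {fun [set: H] >-> [set: H]} := [fun of totalfun phi].
have sq0 : 0 <= Num.sqrt q2 by exact: sqrtr_ge0.
have [||u _ uE] := @banach_fixed_point R H setT f _ closedT.
- exists (NngNum sq0); split; first by rewrite /= -sqrtr1 ltr_sqrt.
  by move=> [u v] _; exact: lip.
- by exists 0.
exists u; have := phiP u; rewrite -[phi u]/(f u) -uE.
rewrite (_ : u - _ + _ - u = t *: (w - T u)).
  by rewrite scalerA mulVf ?gt_eqF// scale1r.
by rewrite scalerBr addrC !addrA addNr add0r addrC.
Qed.

End MaximalMonotone.

Section Resolvents.
Context {R : realType} {H : hilbertType R}.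
Implicit Types (A B D N : H -> set H).

Lemma resolventE N w x : resolvent N w x <-> N x (w - x).
Proof.
split=> [[_ -> [v Nv <-]]|Nx]; first by rewrite addrC addKr.
by exists x => //; exists (w - x) => //; rewrite addrC subrK.
Qed.

Lemma J_graph N w : (exists x, N x (w - x)) -> N (J N w) (w - J N w).
Proof.
move=> [x Nx]; apply/resolventE/(@xgetPex _ 0 (resolvent N w)).
by exists x; apply/resolventE.
Qed.

Lemma J_scale_graph A (rho : R) s : max_monotone A -> 0 < rho ->
  let x := J (op_scale rho^-1 A) (rho^-1 *: s) in A x (s - rho *: x).
Proof.
move=> maxA rho0 /=.
have rhoK v : rho *: (rho^-1 *: v) = v :> H.
  by rewrite scalerA divff ?gt_eqF// scale1r.
have [|v Av] := @J_graph (op_scale rho^-1 A) (rho^-1 *: s).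
  have [|||x Ax] := @max_monotone_add_surj _ _ A ( *:%R rho) rho rho maxA rho0 _ _ _ s.
  - by move=> x y; rewrite -scalerBr dotpZr dotp_norm.
  - exact: ltW.
  - by move=> x y; rewrite -scalerBr normrZ gtr0_norm.
  exists x; exists (s - rho *: x) => //.
  by rewrite scalerBr scalerA mulVf ?gt_eqF// scale1r.
move=> /(congr1 ( *:%R rho)); rewrite rhoK scalerBr rhoK => <-//.
Qed.

Lemma monotone_resolvent_uniq A (rho : R) s x y : monotone_op A -> 0 < rho ->
  A x (s - rho *: x) -> A y (s - rho *: y) -> x = y.
Proof.
move=> mA rho0 Ax Ay; have := mA _ _ _ _ Ax Ay.
have -> : s - rho *: x - (s - rho *: y) = - rho *: (x - y).
  by rewrite opprB addrC subrKA scaleNr -scalerN opprB scalerBr.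
rewrite dotpZr dotp_norm mulNr oppr_ge0 pmulr_rle0//; exact: sub_sqnorm_le0.
Qed.

Lemma max_monotone_inv A : max_monotone A -> max_monotone (op_inv A).
Proof.
move=> /max_monotoneP[mA maxA]; apply/max_monotoneP; split.
  by move=> x y u v Ax Ay; rewrite dotpC; exact: mA.
by move=> x u h; apply: maxA => y v Ay; rewrite dotpC; exact: h.
Qed.

(** Writing the resolvent point as w - T u with u in A (w - T u), the equation
    becomes w - T u in A^-1 u: it is solved for u, and T need not be inverted. *)
Lemma J_comp_graph A (T : H -> H) (c K : R) w : max_monotone A -> 0 < c ->
  (forall x y, c * `|x - y| ^+ 2 <= '<| x - y, T x - T y |>) ->
  0 <= K -> (forall x y, `|T x - T y| <= K * `|x - y|) ->
  exists2 u, A (J (op_comp T A) w) u & w = J (op_comp T A) w + T u.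
Proof.
move=> /max_monotone_inv maxA c0 Tc K0 TK.
have [|u Au uE] := @J_graph (op_comp T A) w.
  have [u Au] := max_monotone_add_surj maxA c0 Tc K0 TK w.
  by exists (w - T u); exists u => //; rewrite subKr.
by exists u => //; rewrite uE addrC subrK.
Qed.

Lemma strongly_monotoneP (nu : R) D x y u v : strongly_monotone nu D ->
  D x u -> D y v -> nu * `|x - y| ^+ 2 <= '<| x - y, u - v |>.
Proof.
move=> sD Dx Dy.
have := sD x y (u + - nu *: x) (v + - nu *: y).
have h z w : D z w -> op_add D (op_scale (- nu) (@op_id R H)) z (w + - nu *: z).
  by move=> Dz; exists w => //; exists (- nu *: z) => //; exists z.
move=> /(_ (h _ _ Dx) (h _ _ Dy)).
have -> : u + - nu *: x - (v + - nu *: y) = (u - v) - nu *: (x - y).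
  by rewrite opprD addrACA !scaleNr opprK scalerBr opprB [nu *: y - _]addrC.
by rewrite dotpDr dotpNr dotpZr dotp_norm subr_ge0.
Qed.

(** The operator D - nu Id is maximally monotone as well, and w in D u means that
    w belongs to nu u + (D - nu Id) u. *)
Lemma strongly_monotone_inv_graph (nu : R) D w : 0 < nu -> max_monotone D ->
  strongly_monotone nu D -> D (to_fun (op_inv D) w) w.
Proof.
move=> nu0 /max_monotoneP[mD maxD] sD.
suff : exists x, op_inv D w x by move=> /(xgetPex 0).
pose M (x : H) := [set u | D x (u + nu *: x)].
have maxM : max_monotone M.
  apply/max_monotoneP; split.
    move=> x y u v Mx My; have := strongly_monotoneP sD Mx My.
    rewrite -dotp_norm !dotpE; lra.
  move=> x u h; apply: maxD => y v Dy; have := h y (v - nu *: y).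
  rewrite /M /= subrK => /(_ Dy).
  have : 0 <= nu * '<| x - y, x - y |> by rewrite mulr_ge0 ?(ltW nu0)// dotp_norm sqr_ge0.
  rewrite !dotpE; lra.
have [|||x Mx] := @max_monotone_add_surj _ _ M ( *:%R nu) nu nu maxM nu0 _ _ _ w.
- by move=> x y; rewrite -scalerBr dotpZr dotp_norm.
- exact: ltW.
- by move=> x y; rewrite -scalerBr normrZ gtr0_norm.
by exists x; move: Mx; rewrite /M /= subrK.
Qed.

End Resolvents.

(** * Weak limits along ultrafilters *)

Section WeakLimits.
Context {R : realType} {H : hilbertType R}.

Lemma ultra_bounded_cvg (F : set_system nat) (u : nat -> R) (M : R) :
  UltraFilter F -> (forall n, `|u n| <= M) -> exists c : R, u @ F --> c.
Proof.
move=> UF uM.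
have FI : (u @ F) `[- M, M]%classic.
  by apply: (@filterE _ F) => n /=; rewrite in_itv /= -ler_norml; exact: uM.
have [c [_ cl]] := @segment_compact R (- M) M (u @ F) _ FI.
exists c => V Vc; have [//|FV] := in_ultra_setVsetC (u @^-1` V) UF.
by have [y [nV /= V']] := cl (~` V) V FV Vc.
Qed.

(** If u did not converge to l, some ultrafilter finer than the filter of
    infinity would contain the indices for which u avoids a neighbourhood of l. *)
Lemma cvg_ultra (u : nat -> R) (l : R) :
  (forall F, UltraFilter F -> \oo `<=` F -> u @ F --> l) -> u @ \oo --> l.
Proof.
move=> ul V Vl; apply: contrapT => nV.
pose G := within (~` (u @^-1` V)) \oo.
have GP : ProperFilter G.
  split; last exact: within_filter.
  move=> h; apply: nV; suff : \oo (u @^-1` V) by [].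
  have h' : \oo [set n | (~` (u @^-1` V)) n -> False] := h.
  by apply: filterS h' => n; exact: contrapT.
have [F [UF GF]] := ultraFilterLemma GP.
have oF : \oo `<=` F.
  by move=> A oA; apply: GF; apply: filterS oA => n An _.
have F1 : F (u @^-1` V) by exact: (ul F UF oF V Vl).
have F2 : F (~` (u @^-1` V)) by apply: GF; exact: withinT.
have : F set0 by rewrite -(setICr (u @^-1` V)); exact: filterI.
exact: filter_not_empty.
Qed.

(** The limits of <u n | y> along F form a bounded linear functional of y.
    Working along an ultrafilter takes the place of extracting a weakly
    convergent subsequence, which in a nonseparable space would need a reduction
    to a separable subspace. *)
Lemma ultra_weak_limit (F : set_system nat) (u : nat -> H) (M : R) :
  UltraFilter F -> (forall n, `|u n| <= M) ->
  exists l, forall y, (fun n => '<| u n, y |>) @ F --> '<| l, y |>.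
Proof.
move=> UF uM.
have uyM y n : `|'<| u n, y |>| <= M * `|y|.
  by apply: (le_trans (dotp_le _ _)); apply: ler_wpM2r.
have /choice[l lP] : forall y, exists c : R, (fun n => '<| u n, y |>) @ F --> c.
  by move=> y; exact: ultra_bounded_cvg (uyM y).
have [|y|u0 u0P] := @riesz R H l M.
- move=> k x y; apply: (@cvg_unique _ _ ((fun n => '<| u n, k *: x + y |>) @ F)) => //.
    exact: lP.
  rewrite (_ : (fun _ => _) = fun n => k * '<| u n, x |> + '<| u n, y |>).
    by apply: cvgD; [apply: cvgMl_tmp|]; exact: lP.
  by apply/funext => n; rewrite dotpDr dotpZr.
- apply: (ler_cvg_to (f := fun n => `|'<| u n, y |>|) (g := fun=> M * `|y|)
    (cvg_norm (lP y)) (cvg_cst _)).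
  by apply: nearW => n; exact: uyM.
- by exists u0 => y; rewrite dotpC -u0P.
Qed.

Lemma weak_strong_dotp (F : set_system nat) {FF : Filter F} (u v : nat -> H) (M : R) x y :
  (forall n, `|u n| <= M) ->
  (forall z, (fun n => '<| u n, z |>) @ F --> '<| x, z |>) ->
  v @ F --> y -> (fun n => '<| u n, v n |>) @ F --> '<| x, y |>.
Proof.
move=> uM ux vy.
rewrite (_ : (fun _ => _) = fun n => '<| u n, y |> + '<| u n, v n - y |>); last first.
  by apply/funext => n; rewrite -dotpDr addrC subrK.
rewrite -[X in _ --> X]addr0; apply: cvgD; first exact: ux.
apply: norm_cvg0.
apply: (@squeeze_cvgr _ _ _ _ (fun=> 0) (fun n => M * `|v n - y|)).
- near=> n; rewrite normr_ge0 /=; apply: (le_trans (dotp_le _ _)).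
  by apply: ler_wpM2r.
- exact: cvg_cst.
- rewrite -[X in _ --> X](mulr0 M); apply: cvgMl_tmp.
  rewrite -(@normr0 _ H); apply: cvg_norm; rewrite -(subrr y).
  by apply: cvgB => //; exact: cvg_cst.
Unshelve. all: by end_near. Qed.

Lemma weak_sub_strong_dotp (F : set_system nat) {FF : Filter F} (u v : nat -> H) (M : R) (x y : H) :
  (forall n, `|u n| <= M) ->
  (forall z, (fun n => '<| u n, z |>) @ F --> '<| x, z |>) ->
  v @ F --> y -> (fun n => '<| u n - x, v n |>) @ F --> (0 : R).
Proof.
move=> uM ux vy; rewrite -(subrr '<| x, y |>).
rewrite (_ : (fun _ => _) = fun n => '<| u n, v n |> - '<| x, v n |>).
  apply: cvgB; first exact: weak_strong_dotp uM ux vy.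
  by apply: dotp_cvg => //; exact: cvg_cst.
by apply/funext => n; rewrite dotpDl dotpNl.
Qed.

Lemma weak_cvg_shift (F : set_system nat) {FF : Filter F} (u v : nat -> H) x :
  (forall z, (fun n => '<| u n, z |>) @ F --> '<| x, z |>) ->
  (fun n => v n - u n) @ F --> 0 ->
  forall z, (fun n => '<| v n, z |>) @ F --> '<| x, z |>.
Proof.
move=> ux uv z.
rewrite (_ : (fun _ => _) = fun n => '<| u n, z |> + '<| v n - u n, z |>); last first.
  by apply/funext => n; rewrite -dotpDl addrC subrK.
rewrite -[X in _ --> X]addr0 -[X in _ --> _ + X](dotp0l z).
by apply: cvgD => //; apply: dotp_cvg => //; exact: cvg_cst.
Qed.

End WeakLimits.

Section Demiclosed.
Context {R : realType} {H : hilbertType R}.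
(** The inequalities 0 <= <q n - y | u n - v> pass to the limit, as products of
    a weakly and a strongly convergent factor; maximality does the rest. *)
Lemma max_monotone_demiclosed (M : H -> set H) (F : set_system nat)
    (FF : ProperFilter F) (q u : nat -> H) (K : R) x c : max_monotone M ->
  (forall n, M (q n) (u n)) -> (forall n, `|q n| <= K) ->
  (forall z, (fun n => '<| q n, z |>) @ F --> '<| x, z |>) ->
  u @ F --> c -> M x c.
Proof.
move=> /max_monotoneP[mM maxM] Mqu qK qx uc; apply: maxM => y v My.
have c0 : (fun=> 0 : R) @ F --> (0 : R) by exact: cvg_cst.
apply: (ler_cvg_to (g := fun n => '<| q n - y, u n - v |>) c0); last first.
  by apply: nearW => n; exact: (mM _ _ _ _ (Mqu n) My).
have uv : (fun n => u n - v) @ F --> c - v by apply: cvgB => //; exact: cvg_cst.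
rewrite (_ : (fun _ => _) = fun n => '<| q n, u n - v |> - '<| y, u n - v |>).
  rewrite dotpDl dotpNl; apply: cvgB; first exact: (weak_strong_dotp qK qx).
  by apply: dotp_cvg; [exact: cvg_cst | exact: uv].
by apply/funext => n; rewrite dotpDl dotpNl.
Qed.
End Demiclosed.

(** * Variable metrics *)

Section Metrics.
Context {R : realType} {H : hilbertType R}.

Lemma max_monotone_zero : max_monotone (fun _ : H => [set 0 : H]).
Proof.
apply/max_monotoneP; split=> [x y _ _ -> ->|x u h]; first by rewrite subrr dotp0r.
have := h (x + u) 0 erefl; rewrite subr0 opprD addrA subrr sub0r dotpNl dotp_norm.
by rewrite oppr_ge0 -[u in `|u|]subr0 => /sub_sqnorm_le0.
Qed.

Lemma Palpha_strong (alpha : R) (U : {linear H -> H}) x y : Palpha alpha U ->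
  alpha * `|x - y| ^+ 2 <= '<| x - y, U x - U y |>.
Proof.
move=> [_ _ /(_ (x - y))]; rewrite dotpZl dotp_norm (linearB U) dotpC.
exact.
Qed.

(** W is U^-1, whose form gives the norm in which the resolvent of U M is
    nonexpansive.  The constants are those of U: alpha from below, mu from above. *)
Definition inverse_metric (alpha mu : R) (U W : {linear H -> H}) :=
  [/\ cancel U W, cancel W U, self_adjoint W,
    forall x, `|W x| <= alpha^-1 * `|x| & forall x, `|x| ^+ 2 <= mu * '<| W x, x |>].

(** Surjectivity of U is that of T u + M u for M = 0.  The upper bound on W is
    alpha |W x|^2 <= <U (W x) | W x>, and the lower one is [psd_bounded_sq] for
    U at W x. *)
Lemma metric_inverse (alpha mu : R) (U : {linear H -> H}) :
  0 < alpha -> 0 <= mu -> Palpha alpha U -> (forall x, `|U x| <= mu * `|x|) ->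
  exists W : {linear H -> H}, inverse_metric alpha mu U W.
Proof.
move=> a0 mu0 PU Ub.
have [_ sU aU] := PU.
have Us := fun x y => @Palpha_strong _ _ x y PU.
have UL x y : `|U x - U y| <= mu * `|x - y| by rewrite -linearB; exact: Ub.
have /choice[W WK] : forall w, exists x, w - U x = 0.
  by move=> w; exact: (max_monotone_add_surj max_monotone_zero a0 Us mu0 UL).
have {}WK : cancel W U by move=> x; apply/esym/eqP; rewrite -subr_eq0 WK.
have Uinj : injective U.
  move=> x y Uxy; have := Us x y; rewrite Uxy subrr dotp0r pmulr_rle0//; exact: sub_sqnorm_le0.
have UK : cancel U W by move=> x; apply: Uinj; rewrite WK.
have Wlin : linear W by move=> k x y; apply: Uinj; rewrite linearP !WK.
pose Wm := GRing.isLinear.Build R H H *:%R W Wlin.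
pose W' : {linear H -> H} := HB.pack W Wm.
exists W'; split => //.
- by move=> x y /=; rewrite -{1}(WK y) -(sU (W x)) WK.
- move=> x /=; rewrite mulrC ler_pdivlMr// mulrC.
  have h : alpha * `|W x| ^+ 2 <= '<| W x, x |>.
    by have := aU (W x); rewrite WK dotpZl dotp_norm (dotpC x).
  have [->|n0] := eqVneq `|W x| 0; first by rewrite mulr0.
  have np : 0 < `|W x| by rewrite lt0r n0 /=.
  rewrite -(ler_pM2l np) mulrCA -expr2; apply: (le_trans h); exact: dotp_ler.
- move=> x /=; have := @psd_bounded_sq _ _ U mu sU _ mu0 Ub (W x).
  rewrite WK dotpC; apply => y; apply: le_trans (aU y).
  by rewrite dotpZl dotp_norm mulr_ge0 ?(ltW a0)// sqr_ge0.
Qed.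

(** Inversion reverses the Loewner order: Cauchy-Schwarz for the form of U at
    Wu x and Wv x gives <Wv x | x>^2 <= <Wu x | x> <U (Wv x) | Wv x>. *)
Lemma inverse_loewner (k : R) (U V Wu Wv : {linear H -> H}) :
  self_adjoint U -> (forall x, 0 <= '<| U x, x |>) ->
  cancel Wu U -> cancel Wv V ->
  0 <= k -> (forall x, '<| U x, x |> <= k * '<| V x, x |>) ->
  forall x, '<| Wv x, x |> <= k * '<| Wu x, x |>.
Proof.
move=> sU pU WuK WvK k0 UV x.
have := psd_CS sU pU (Wu x) (Wv x); rewrite WuK.
have := UV (Wv x); rewrite WvK (dotpC (Wv x) x).
have := pU (Wu x); rewrite WuK (dotpC (Wu x)).
set a := '<| x, Wv x |>; set b := '<| x, Wu x |>; set c := '<| U (Wv x), Wv x |>.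
move=> b0 ck h; rewrite leNgt; apply/negP => lt.
have a0 : 0 < a by apply: le_lt_trans lt; rewrite mulr_ge0.
have := ler_wpM2l b0 ck; have : k * b * a < a * a by rewrite ltr_pM2r.
move: h; rewrite expr2; lra.
Qed.

(** Divided by the products of the 1 + eta k, the forms <W n x | x> decrease and
    hence converge; for the positive differences, [psd_bounded_sq] upgrades this
    to the Cauchy property of the vectors themselves. *)
Lemma metric_limit (W : nat -> {linear H -> H}) (c : R) (eta : nat -> R) :
  (forall n, self_adjoint (W n)) -> (forall n x, 0 <= '<| W n x, x |>) ->
  0 <= c -> (forall n x, `|W n x| <= c * `|x|) ->
  (forall n, 0 <= eta n) -> cvgn (series eta) ->
  (forall n x, '<| W n.+1 x, x |> <= (1 + eta n) * '<| W n x, x |>) ->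
  forall x, cvgn (fun n => W n x).
Proof.
move=> sW pW c0 Wc eta0 ceta Wmon x.
have [p p1 Pp] := cvg_prod1D eta0 ceta.
pose q n : R := \prod_(k < n) (1 + eta k).
have q1 n : 1 <= q n by exact: prod1D_ge1.
have q0 n : 0 < q n by apply: lt_le_trans (q1 n).
pose T n : {linear H -> H} := (q n)^-1 \*: W n.
have Tle y : {homo (fun n => '<| T n y, y |>) : n m / (n <= m)%N >-> m <= n}.
  apply/nonincreasing_seqP => n; rewrite /T /= !dotpZl.
  rewrite ler_pdivrMl//; apply: (le_trans (Wmon n y)).
  rewrite /q big_ord_recr /= -/(q n) mulrA [_ * (1 + _)]mulrC -(mulrA (1 + _)).
  by rewrite mulfV ?gt_eqF// mulr1.
have Tc n y : `|T n y| <= c * `|y|.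
  rewrite /T /= normrZ ger0_norm ?invr_ge0 ?(ltW (q0 n))//.
  apply: le_trans (Wc n y); rewrite ler_piMl// invf_le1//.
have sT n m : self_adjoint (T n \- T m).
  by move=> y z; rewrite /T /= !dotpE !sW.
have [d dP] : exists d : R, (fun n => '<| T n x, x |>) @ \oo --> d.
  apply/cvg_ex; apply: nonincreasing_is_cvgn; first exact: Tle.
  exists 0 => _ [n _ <-]; rewrite /T /= dotpZl mulr_ge0 ?invr_ge0 ?(ltW (q0 n))//.
have TC : cvgn (fun n => T n x).
  apply: (@cauchy_sq_cvg _ _ _ (fun n => 2 * c * `|'<| T n x, x |> - d|)).
    rewrite -[X in _ --> X](mulr0 (2 * c)); apply: cvgMl_tmp.
    rewrite -[X in _ --> X](@normr0 _ R); apply: cvg_norm.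
    by rewrite -(subrr d); apply: cvgB => //; exact: cvg_cst.
  move=> n m; wlog nm : n m / (n <= m)%N.
    move=> h; have [/h//|/ltnW/h h1] := leqP n m.
    by rewrite distrC [leRHS]addrC.
  have c20 : 0 <= 2 * c by rewrite mulr_ge0.
  have := @psd_bounded_sq _ _ (T n \- T m) (2 * c) (sT n m) _ c20 _ x.
  move=> /= h; apply: (le_trans (h _ _)).
  - by move=> y; rewrite dotpDl dotpNl subr_ge0; exact: Tle.
  - move=> y; apply: (le_trans (ler_normB _ _)).
    by have := Tc n y; have := Tc m y; rewrite /T /=; lra.
  - rewrite -mulrDr; apply: ler_wpM2l => //.
    rewrite dotpDl dotpNl; set u := '<| _, _ |>; set v := '<| _, _ |>.
    have := ler_norm (u - d); have := ler_norm (- (v - d)); rewrite normrN; lra.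
have -> : (fun n => W n x) = (fun n => q n *: T n x).
  by apply/funext => n; rewrite /T /= scalerA mulfV ?gt_eqF// scale1r.
apply: is_cvgZ => //; by apply/cvg_ex; exists p.
Qed.

End Metrics.

(** * The variable metric forward-backward iteration *)

(** One step in one space: v is the current point, q the resolvent point and u the
    element of M q that realises it, c the value of C at v, and vb a zero with
    value cb, so that - cb belongs to M vb. *)
Section ForwardBackwardStep.
Context {R : realType} {H : hilbertType R} (W : {linear H -> H}).
Hypothesis sW : self_adjoint W.

(** Expand the W-norm of v - vb = (v - q) + (q - vb); the cross term is
    2 gamma <c + u | q - vb>, and monotonicity bounds the part <u + cb | q - vb>
    from below. *)
Lemma fb_descent (gamma : R) (q v vb c cb u : H) : 0 <= gamma ->
  W (v - q) = gamma *: (c + u) -> 0 <= '<| q - vb, u + cb |> ->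
  '<| W (q - vb), q - vb |> + '<| W (v - q), v - q |> <=
  '<| W (v - vb), v - vb |> + 2 * gamma * '<| v - q, c - cb |>
  - 2 * gamma * '<| v - vb, c - cb |>.
Proof.
move=> g0; have -> : v - vb = (v - q) + (q - vb) by rewrite addrA subrK.
move: (v - q) (q - vb) => x y Wx h.
rewrite (linearD W) !dotpE (sW y x) (dotpC y (W x)) Wx.
have := mulr_ge0 g0 h; rewrite !dotpE (dotpC c y) (dotpC u y); lra.
Qed.

Hypothesis pW : forall x, 0 <= '<| W x, x |>.

(** Young's inequality for <v - q | c - cb> with the weight 2 beta - eps / 2,
    which lies strictly between the largest possible gamma mu and 2 beta: a
    positive multiple of each of the two squares is left over. *)
Lemma fb_step (mu beta eps gamma : R) (q v vb c cb u : H) :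
  (forall x, `|x| ^+ 2 <= mu * '<| W x, x |>) -> 0 < mu -> 0 < eps ->
  eps <= gamma <= (2 * beta - eps) / mu ->
  W (v - q) = gamma *: (c + u) -> 0 <= '<| q - vb, u + cb |> ->
  '<| W (q - vb), q - vb |> + eps / (2 * mu * (2 * beta - eps / 2)) * `|v - q| ^+ 2
     + eps ^+ 2 / 2 * `|c - cb| ^+ 2 <=
  '<| W (v - vb), v - vb |>
  - 2 * gamma * ('<| v - vb, c - cb |> - beta * `|c - cb| ^+ 2).
Proof.
move=> Wmu mu0 e0 /andP[eg gb] WE h.
have g0 : 0 < gamma by exact: lt_le_trans eg.
have b0 : 0 < 2 * beta - eps.
  by have := lt_le_trans g0 gb; rewrite pmulr_lgt0// invr_gt0.
set k := 2 * beta - eps / 2.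
have k0 : 0 < k by rewrite /k; lra.
have := fb_descent (ltW g0) WE h; move: (v - vb) (v - q) (c - cb) => x y d D.
have Wy : mu^-1 * `|y| ^+ 2 <= '<| W y, y |> by rewrite ler_pdivrMl.
have young : 2 * '<| y, d |> <= k^-1 * `|y| ^+ 2 + k * `|d| ^+ 2.
  have : 0 <= k^-1 * '<| y - k *: d, y - k *: d |>.
    by rewrite mulr_ge0 ?invr_ge0 ?(ltW k0)// dotp_norm sqr_ge0.
  rewrite -!dotp_norm !dotpE (dotpC d y) => hh; rewrite -subr_ge0.
  apply: le_trans hh _; rewrite le_eqVlt; apply/orP; left; apply/eqP.
  by field; rewrite gt_eqF.
have := ler_wpM2l (ltW g0) young.
have gk : gamma * k^-1 <= mu^-1 - eps / (2 * mu * k).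
  have -> : mu^-1 - eps / (2 * mu * k) = (2 * beta - eps) / mu / k.
    by rewrite /k; field; rewrite ?gt_eqF//= -/k; rewrite ?gt_eqF//; lra.
  by rewrite ler_pM2r ?invr_gt0.
have := ler_wpM2r (sqr_ge0 `|y|) gk.
have ge : eps ^+ 2 / 2 <= 2 * gamma * beta - gamma * k.
  have : eps * eps <= gamma * eps by rewrite ler_pM2r.
  rewrite /k expr2; lra.
have := ler_wpM2r (sqr_ge0 `|d|) ge.
lra.
Qed.

(** Firm nonexpansiveness of the resolvent in the metric W. *)
Lemma resolvent_perturbation (mu gamma : R) (p q w1 w2 u1 u2 : H) :
  (forall x, `|x| ^+ 2 <= mu * '<| W x, x |>) -> 0 <= mu -> 0 <= gamma ->
  W (w1 - p) = gamma *: u1 -> W (w2 - q) = gamma *: u2 ->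
  0 <= '<| p - q, u1 - u2 |> -> `|p - q| <= mu * `|W (w1 - w2)|.
Proof.
move=> Wmu mu0 g0 W1 W2 h.
have := mulr_ge0 g0 h; rewrite -dotpZr scalerBr -W1 -W2 -linearB.
have -> : w1 - p - (w2 - q) = (w1 - w2) - (p - q).
  by rewrite !opprD addrACA.
move: (p - q) (w1 - w2) => y d; rewrite (linearB W) dotpDr dotpNr subr_ge0 => h1.
have [->|n0] := eqVneq `|y| 0; first by rewrite mulr_ge0.
have np : 0 < `|y| by rewrite lt0r n0 /=.
rewrite -(ler_pM2r np) -expr2; apply: (le_trans (Wmu y)).
rewrite -mulrA; apply: ler_wpM2l => //; rewrite dotpC; apply: (le_trans h1).
by rewrite mulrC; exact: dotp_ler.
Qed.

Lemma form_convex (l : R) (x y : H) : 0 <= l <= 1 ->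
  '<| W (x + l *: (y - x)), x + l *: (y - x) |> <=
  (1 - l) * '<| W x, x |> + l * '<| W y, y |>.
Proof.
move=> /andP[l0 l1].
have h : 0 <= l * (1 - l) * '<| W (y - x), y - x |> by rewrite !mulr_ge0// subr_ge0.
move: h; rewrite !(linearD W) (linearZ_LR W) !(linearD W) !(linearN W) !dotpE.
rewrite !(sW y x) !(dotpC y (W x)); lra.
Qed.

(** The cross term is bounded by 2 |y|_W E <= E (1 + |y|_W^2).  This is linear in
    E, so that it suffices to have summable errors E. *)
Lemma form_perturbation (E : R) (y e : H) : 0 <= E -> '<| W e, e |> <= E ^+ 2 ->
  '<| W (y + e), y + e |> <= (1 + E) * '<| W y, y |> + (E + E ^+ 2).
Proof.
move=> E0 eE; rewrite (linearD W) !dotpE (sW e y) (dotpC e (W y)).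
suff : 2 * '<| W y, e |> <= E * (1 + '<| W y, y |>) by lra.
have CS := psd_CS sW pW y e; have p0 := pW y.
have E1 : 0 <= E * (1 + '<| W y, y |>) by rewrite mulr_ge0// addr_ge0.
have [h|h] := leP '<| W y, e |> 0.
  by apply: le_trans E1; rewrite mulr_ge0_le0.
have h2 : 0 <= 2 * '<| W y, e |> by rewrite mulr_ge0// ltW.
rewrite -(@ler_pXn2r _ 2)//.
have h1 := ler_wpM2l p0 eE.
have : 0 <= E ^+ 2 * (1 - '<| W y, y |>) ^+ 2 by rewrite mulr_ge0 ?sqr_ge0.
rewrite !exprMn; lra.
Qed.

End ForwardBackwardStep.

(** The variable metric forward-backward algorithm for 0 in M v + C v on the
    direct sum of the G i.  M, U and W act componentwise, whereas C couples the
    components. The sequences e and b are the errors in C and in the resolvent. *)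
Section VariableMetricForwardBackward.
Context {R : realType} {m : nat} {G : 'I_m -> hilbertType R}.
Variables (M : forall i, G i -> set (G i)).
Variables (C : (forall i, G i) -> forall i, G i) (beta : R).
Hypothesis M_max : forall i, max_monotone (@M i).
Hypothesis C_coco : forall v v', beta * \sum_i `|C v i - C v' i| ^+ 2 <=
  \sum_i '<| v i - v' i, C v i - C v' i |>.
Variables (U W : forall i, nat -> {linear G i -> G i}) (alpha mu : R) (eta : nat -> R).
Hypotheses (alpha_gt0 : 0 < alpha) (mu_gt0 : 0 < mu).
Hypothesis eta_nns : nnsummable eta.
Hypothesis U_P : forall i n, Palpha alpha (U i n).
Hypothesis U_le : forall i n x, `|U i n x| <= mu * `|x|.
Hypothesis U_mono : forall i n, loewner_ge ((1 + eta n) \*: U i n.+1) (U i n).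
Hypothesis W_inv : forall i n, inverse_metric alpha mu (U i n) (W i n).
Variables (eps : R) (lambda gamma : nat -> R).
Hypothesis eps_gt0 : 0 < eps.
Hypothesis lambda_bounds : forall n, eps <= lambda n <= 1.
Hypothesis gamma_bounds : forall n, eps <= gamma n <= (2 * beta - eps) / mu.
Variables (v e b : forall i, nat -> G i).
Hypothesis e_nns : forall i, nnsummable (fun n => `|e i n|).
Hypothesis b_nns : forall i, nnsummable (fun n => `|b i n|).

Let V n i : G i := v i n.
Let JM i n w : G i := J (op_comp (gamma n \*: U i n) (@M i)) w.
(* p is the computed resolvent point, q the one that the error e would leave
   unperturbed. *)
Let p i n := JM n (v i n - gamma n *: U i n (C (V n) i + e i n)).
Let q i n := JM n (v i n - gamma n *: U i n (C (V n) i)).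

Hypothesis v_def : forall i n,
  v i n.+1 = v i n + lambda n *: (p i n + b i n - v i n).

Definition fb_zero (vb : forall i, G i) := forall i, M (vb i) (- C vb i).

Let gamma_gt0 n : 0 < gamma n.
Proof. by have /andP[+ _] := gamma_bounds n; exact: lt_le_trans. Qed.

Let beta_gt : eps * mu <= 2 * beta - eps.
Proof.
have /andP[h1 h2] := gamma_bounds 0.
by rewrite -ler_pdivlMr//; exact: le_trans h2.
Qed.

Let beta_gt0 : 0 < beta.
Proof. by have := mulr_gt0 eps_gt0 mu_gt0; have := beta_gt; have := eps_gt0; lra. Qed.

Let pW i n x : 0 <= '<| W i n x, x |>.
Proof.
have [_ _ _ _ /(_ x)] := W_inv i n => h.
by have := le_trans (sqr_ge0 _) h; rewrite pmulr_rge0.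
Qed.

Let sW i n : self_adjoint (W i n). Proof. by case: (W_inv i n). Qed.

Lemma JM_graph i n w : exists2 u, M (JM n w) u & W i n (w - JM n w) = gamma n *: u.
Proof.
have [||||u Mu wE] := @J_comp_graph _ _ (@M i) (gamma n \*: U i n)
  (gamma n * alpha) (gamma n * mu) w (@M_max i).
- by rewrite mulr_gt0.
- move=> x y /=; rewrite -scalerBr dotpZr -mulrA; apply: ler_wpM2l; first exact: ltW.
  exact: Palpha_strong (U_P i n).
- by rewrite mulr_ge0// ltW.
- move=> x y /=; rewrite -scalerBr normrZ gtr0_norm// -mulrA -linearB.
  by apply: ler_wpM2l; [exact: ltW | exact: U_le].
exists u => //; rewrite {1}wE -/(JM n w) addrAC subrr add0r /= linearZ /=.
by have [-> _ _ _ _] := W_inv i n.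
Qed.

Let W_step i n w c u : W i n (v i n - gamma n *: U i n c - w) = gamma n *: u ->
  W i n (v i n - w) = gamma n *: (c + u).
Proof.
have [UK _ _ _ _] := W_inv i n.
move=> h; rewrite scalerDr -h -[in gamma n *: c](UK c) -(linearZ_LR (W i n)).
rewrite -linearD; congr (W i n _); apply: dotp_inj => t; rewrite !dotpE; ring.
Qed.

Let pq_le i n : `|p i n - q i n| <= 2 * beta * `|e i n|.
Proof.
have [u Mp pE] := JM_graph n (v i n - gamma n *: U i n (C (V n) i + e i n)).
have [u' Mq qE] := JM_graph n (v i n - gamma n *: U i n (C (V n) i)).
have [UK _ _ _ Wmu] := W_inv i n.
have := resolvent_perturbation Wmu (ltW mu_gt0) (ltW (gamma_gt0 n)) pE qE
  ((M_max i).1 _ _ _ _ Mp Mq).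
move=> /le_trans; apply.
rewrite (_ : v i n - _ - _ = - gamma n *: U i n (e i n)); last first.
  by rewrite linearD; apply: dotp_inj => t; rewrite !dotpE; ring.
rewrite linearZ /= UK normrZ normrN gtr0_norm// mulrA; apply: ler_wpM2r => //.
have /andP[_] := gamma_bounds n; rewrite ler_pdivlMr// mulrC => /le_trans; apply.
by rewrite gerBl ltW.
Qed.

Let Q vb n := \sum_i '<| W i n (v i n - vb i), v i n - vb i |>.
(* The constants of fb_step. *)
Let d1 := eps / (2 * mu * (2 * beta - eps / 2)).
Let d2 := eps ^+ 2 / 2.
Let gap vb n := \sum_i (d1 * `|v i n - q i n| ^+ 2 + d2 * `|C (V n) i - C vb i| ^+ 2).

Let d1_gt0 : 0 < d1.
Proof.
rewrite divr_gt0// !mulr_gt0//.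
have := mulr_gt0 eps_gt0 mu_gt0; have := beta_gt; have := eps_gt0; lra.
Qed.

Let d2_gt0 : 0 < d2. Proof. by rewrite divr_gt0// exprn_gt0. Qed.

Let gap_ge0 vb n : 0 <= gap vb n.
Proof. by apply: sumr_ge0 => i _; rewrite addr_ge0// mulr_ge0 ?sqr_ge0// ltW. Qed.

Let Q_ge0 vb n : 0 <= Q vb n. Proof. by apply: sumr_ge0. Qed.

(** The terms with the factor - 2 gamma n add up to something nonpositive by
    cocoercivity, which holds for the whole family and not for each i. *)
Lemma fb_sum_step vb n : fb_zero vb ->
  \sum_i '<| W i n (q i n - vb i), q i n - vb i |> + gap vb n <= Q vb n.
Proof.
move=> zb.
have le_i i : '<| W i n (q i n - vb i), q i n - vb i |>
    + (d1 * `|v i n - q i n| ^+ 2 + d2 * `|C (V n) i - C vb i| ^+ 2) <=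
    '<| W i n (v i n - vb i), v i n - vb i |>
    - 2 * gamma n * ('<| v i n - vb i, C (V n) i - C vb i |>
       - beta * `|C (V n) i - C vb i| ^+ 2).
  have [u Mq qE] := JM_graph n (v i n - gamma n *: U i n (C (V n) i)).
  have [_ _ _ _ Wmu] := W_inv i n.
  rewrite addrA; apply: (fb_step (@sW i n) Wmu mu_gt0 eps_gt0 (gamma_bounds n) (W_step qE)).
  by have := (M_max i).1 _ _ _ _ Mq (zb i); rewrite opprK.
rewrite -big_split /=; apply: (le_trans (ler_sum _ (fun i _ => le_i i))).
rewrite sumrB gerBl -mulr_sumr mulr_ge0 ?mulr_ge0 ?(ltW (gamma_gt0 n))//.
by rewrite sumrB -mulr_sumr subr_ge0; exact: C_coco.
Qed.

(* Since kap dominates both 1 and 1 / alpha, its square dominates 1 / alpha, so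
   that kap |y| bounds the W-norm of y. *)
Let kap := 1 + alpha^-1.
Let E n := kap * \sum_i (2 * beta * `|e i n| + `|b i n|).

Let kap_ge1 : 1 <= kap. Proof. by rewrite lerDl invr_ge0 ltW. Qed.

Let E_nns : nnsummable E.
Proof.
apply: nnsummableZ; first exact: le_trans kap_ge1.
apply: nnsummable_sum => i; apply: nnsummableD => //.
by apply: nnsummableZ => //; rewrite mulr_ge0// ltW.
Qed.

Let err i n := lambda n *: (p i n - q i n + b i n).

Let lambda_ge0 n : 0 <= lambda n.
Proof. by have /andP[h _] := lambda_bounds n; apply: le_trans h; exact: ltW. Qed.

Let err_le i n : '<| W i n (err i n), err i n |> <= E n ^+ 2.
Proof.
have [_ _ _ Wal _] := W_inv i n.
apply: (le_trans (dotp_ler _ _)).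
have k0 : 0 <= kap by exact: le_trans kap_ge1.
have hE : kap * `|err i n| <= E n.
  apply: ler_wpM2l => //.
  rewrite (bigD1 i)//= -[leLHS]addr0; apply: lerD; last first.
    by apply: sumr_ge0 => j _; rewrite addr_ge0// mulr_ge0// mulr_ge0// ltW.
  have /andP[_ l1] := lambda_bounds n.
  rewrite /err normrZ ger0_norm//; apply: (le_trans (ler_piMl _ l1)) => //.
  by apply: (le_trans (ler_normD _ _)); rewrite lerD2r; exact: pq_le.
apply: (@le_trans _ _ ((kap * `|err i n|) ^+ 2)); last first.
  by rewrite ler_pXn2r ?nnegrE//; [exact: mulr_ge0 | exact: E_nns.1].
rewrite exprMn expr2 [_ ^+ 2]expr2 mulrA; apply: ler_wpM2r => //.
apply: (le_trans (Wal _)); apply: ler_wpM2r => //.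
apply: (@le_trans _ _ kap); first by rewrite lerDr.
by rewrite ler_peMl.
Qed.

Lemma W_mono i n x : '<| W i n.+1 x, x |> <= (1 + eta n) * '<| W i n x, x |>.
Proof.
have [_ WK _ _ _] := W_inv i n; have [_ WK' _ _ _] := W_inv i n.+1.
have [_ sU aU] := U_P i n.
have e1 : 0 <= 1 + eta n by rewrite addr_ge0// eta_nns.1.
apply: (inverse_loewner sU _ WK WK' e1) => [y|y].
  by apply: le_trans (aU y); rewrite dotpZl dotp_norm mulr_ge0 ?sqr_ge0// ltW.
by apply: (le_trans (@U_mono i n y)); rewrite dotpZl.
Qed.

Let al n := eta n + (E n + eta n * E n).
Let be n := m%:R * ((E n + E n * E n) + eta n * (E n + E n * E n)).

Let al_nns : nnsummable al.
Proof.
by apply: nnsummableD => //; apply: nnsummableD => //; exact: nnsummableM.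
Qed.

Let be_nns : nnsummable be.
Proof.
have h : nnsummable (fun n => E n + E n * E n).
  by apply: nnsummableD => //; exact: nnsummableM.
by apply: nnsummableZ => //; apply: nnsummableD => //; exact: nnsummableM.
Qed.

(** The new point is a W-convex combination of v and q, up to err; the change of
    metric costs the factor 1 + eta n, and al and be collect the products of the
    summable terms. *)
Lemma fb_lyapunov vb n : fb_zero vb ->
  Q vb n.+1 <= (1 + al n) * Q vb n - eps * gap vb n + be n.
Proof.
move=> zb; have step := fb_sum_step n zb.
have E0 := E_nns.1 n; have e0 := eta_nns.1 n.
pose y i := v i n - vb i + lambda n *: ((q i n - vb i) - (v i n - vb i)).
have le_i i : '<| W i n.+1 (v i n.+1 - vb i), v i n.+1 - vb i |> <=
   (1 + eta n) * ((1 + E n) * '<| W i n (y i), y i |> + (E n + E n ^+ 2)).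
  apply: (le_trans (W_mono _ _)); apply: ler_wpM2l; first exact: addr_ge0.
  rewrite v_def (_ : _ - vb i = y i + err i n).
    exact: form_perturbation.
  by apply: dotp_inj => t; rewrite /y /err !dotpE; ring.
have lb := lambda_bounds n.
have y_i i : '<| W i n (y i), y i |> <= (1 - lambda n) * '<| W i n (v i n - vb i), v i n - vb i |>
    + lambda n * '<| W i n (q i n - vb i), q i n - vb i |>.
  by apply: form_convex => //; rewrite lambda_ge0; case/andP: lb.
have ySum : \sum_i '<| W i n (y i), y i |> <= Q vb n - eps * gap vb n.
  apply: (le_trans (ler_sum _ (fun i _ => y_i i))).
  rewrite big_split /= -!mulr_sumr -/(Q vb n).
  have h1 := ler_wpM2l (lambda_ge0 n) step.
  have h2 : eps * gap vb n <= lambda n * gap vb n.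
    by apply: ler_wpM2r; [exact: gap_ge0 | case/andP: lb].
  move: h1; rewrite mulrDr; lra.
apply: (le_trans (ler_sum _ (fun i _ => le_i i))).
rewrite -mulr_sumr big_split /= -mulr_sumr sumr_const card_ord -mulr_natl.
have h1 : (1 + E n) * \sum_i '<| W i n (y i), y i |> <= (1 + E n) * (Q vb n - eps * gap vb n).
  by apply: ler_wpM2l => //; exact: addr_ge0.
have h2 := ler_wpM2l (addr_ge0 ler01 e0) h1.
have g0 : 0 <= eps * gap vb n by rewrite mulr_ge0// ltW.
have h3 : 0 <= (eta n + (E n + eta n * E n)) * (eps * gap vb n).
  by rewrite mulr_ge0// addr_ge0// addr_ge0// mulr_ge0.
rewrite /al /be expr2; lra.
Qed.

Lemma fb_fejer vb : fb_zero vb -> [/\ cvgn (Q vb),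
  forall i, (fun n => v i n - q i n) @ \oo --> 0 &
  forall i, (fun n => C (V n) i) @ \oo --> C vb i].
Proof.
move=> zb.
have [|||||||cQ t0] := @quasi_fejer_cvg R (Q vb) (fun n => eps * gap vb n) al be.
- exact: Q_ge0.
- by move=> n; rewrite mulr_ge0// ltW.
- exact: al_nns.1.
- exact: be_nns.1.
- exact: al_nns.2.
- exact: be_nns.2.
- by move=> n; exact: fb_lyapunov.
have gap0 : gap vb @ \oo --> (0 : R).
  rewrite (_ : gap vb = fun n => eps^-1 * (eps * gap vb n)).
    by rewrite -[X in _ --> X](mulr0 eps^-1); apply: cvgMl_tmp.
  by apply/funext => n; rewrite mulrA mulVf ?mul1r ?gt_eqF.
have gap_i i n : d1 * `|v i n - q i n| ^+ 2 + d2 * `|C (V n) i - C vb i| ^+ 2 <= gap vb n.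
  rewrite /gap (bigD1 i)//= lerDl; apply: sumr_ge0 => j _.
  by rewrite addr_ge0// mulr_ge0 ?sqr_ge0// ltW.
split=> // i.
- apply: (@sq_le_cvg0 _ _ _ (fun n => d1^-1 * gap vb n)) => [n|].
    rewrite ler_pdivlMl//; apply: le_trans (gap_i i n).
    by rewrite lerDl mulr_ge0 ?sqr_ge0// ltW.
  by rewrite -[X in _ --> X](mulr0 d1^-1); apply: cvgMl_tmp.
- apply/subr_cvg0; apply: (@sq_le_cvg0 _ _ _ (fun n => d2^-1 * gap vb n)) => [n|].
    rewrite ler_pdivlMl//; apply: le_trans (gap_i i n).
    by rewrite lerDr mulr_ge0 ?sqr_ge0// ltW.
  by rewrite -[X in _ --> X](mulr0 d2^-1); apply: cvgMl_tmp.
Qed.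

Lemma fb_bounded vb : fb_zero vb -> exists K, forall i n, `|v i n| <= K /\ `|q i n| <= K.
Proof.
move=> zb; have [cQ _ _] := fb_fejer zb.
have [K QK] : exists K, forall n, Q vb n <= K.
  have [K [_ /(_ (K + 1) _) h]] := cvg_seq_bounded cQ.
  exists (K + 1) => n; apply: le_trans (ler_norm _) _; apply: h => //.
  by rewrite ltrDl.
have le1 (i : 'I_m) n (y : G i) : '<| W i n y, y |> <= K -> `|y| <= 1 + mu * K.
  move=> h; have [_ _ _ _ /(_ y) h1] := W_inv i n.
  have h2 := le_trans h1 (ler_wpM2l (ltW mu_gt0) h).
  have := sqr_ge0 (`|y| - 1); rewrite sqrrB expr1n mulr1.
  have := normr_ge0 y; lra.
exists (\sum_i `|vb i| + (1 + mu * K)) => i n.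
have bi : `|vb i| <= \sum_i `|vb i|.
  by rewrite (bigD1 i)//= lerDl; apply: sumr_ge0.
have tri (y : G i) : `|y - vb i| <= 1 + mu * K -> `|y| <= \sum_i `|vb i| + (1 + mu * K).
  move=> h; rewrite -[y](subrK (vb i)) addrC.
  by apply: (le_trans (ler_normD _ _)); apply: lerD.
split; apply: tri; apply: (@le1 i n).
- apply: le_trans (QK n); rewrite /Q (bigD1 i)//= lerDl.
  by apply: sumr_ge0.
- apply: le_trans (QK n); apply: le_trans (fb_sum_step n zb).
  apply: (@le_trans _ _ (\sum_i '<| W i n (q i n - vb i), q i n - vb i |>)).
    by rewrite (bigD1 i)//= lerDl; apply: sumr_ge0.
  by rewrite lerDl.
Qed.

(** Cocoercivity, passed to the limit along F, gives C v' = C vb.  Since v - q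
    tends to 0, the elements of M (q i n) given by the resolvent converge
    strongly to - C vb, and M is demiclosed. *)
Lemma fb_cluster vb (F : set_system nat) : fb_zero vb -> UltraFilter F -> \oo `<=` F ->
  exists v', fb_zero v' /\
    forall i y, (fun n => '<| v i n, y |>) @ F --> '<| v' i, y |>.
Proof.
move=> zb UF oF.
have [K vqK] := fb_bounded zb.
have [_ vq Cv] := fb_fejer zb.
have /fin_all_exists[v' v'P] : forall i, exists l : G i, forall y,
    (fun n => '<| v i n, y |>) @ F --> '<| l, y |>.
  by move=> i; apply: (ultra_weak_limit UF (M := K)) => n; case: (vqK i n).
have Cv' i : C v' i = C vb i.
  have lim : (fun n => \sum_i '<| v i n - v' i, C (V n) i - C v' i |>) @ F --> (0 : R).
    rewrite -[X in _ --> X](_ : \sum_(i < m) 0 = 0); last by rewrite big1.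
    apply: (@cvg_sum_fin R _ F _ (fun j n => '<| v j n - v' j, C (V n) j - C v' j |>)) => j.
    apply: (weak_sub_strong_dotp (M := K) _ (v'P j)) => [n|]; first by case: (vqK j n).
    by apply: cvgB; [exact: (cvg_trans (cvg_app _ oF) (Cv j)) | exact: cvg_cst].
  have lim2 : (fun n => beta * \sum_i `|C (V n) i - C v' i| ^+ 2) @ F -->
      beta * \sum_i `|C vb i - C v' i| ^+ 2.
    apply: cvgMl_tmp; apply: cvg_sum_fin => j; rewrite !expr2.
    apply: cvgM; apply: cvg_norm; (apply: cvgB; [exact: (cvg_trans (cvg_app _ oF) (Cv j)) | exact: cvg_cst]).
  have h : beta * \sum_i `|C vb i - C v' i| ^+ 2 <= 0.
    apply: (ler_cvg_to lim2 lim); apply: nearW => n; exact: C_coco.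
  rewrite pmulr_rle0// in h.
  apply/esym/sub_sqnorm_le0/(le_trans _ h).
  by rewrite (bigD1 i)//= lerDl; apply: sumr_ge0 => j _; exact: sqr_ge0.
exists v'; split=> // i; rewrite Cv'.
have /choice[u uP] : forall n, exists u, M (q i n) u /\
    W i n (v i n - q i n) = gamma n *: (C (V n) i + u).
  by move=> n; have [u Mu uE] := JM_graph n (v i n - gamma n *: U i n (C (V n) i));
    exists u; split=> //; exact: W_step.
have uE n : u n = (gamma n)^-1 *: W i n (v i n - q i n) - C (V n) i.
  rewrite (uP n).2 scalerA mulVf ?gt_eqF// scale1r.
  by rewrite addrC addKr.
apply: (@max_monotone_demiclosed _ _ (@M i) F _ (q i) u K) => //.
- by move=> n; case: (uP n).
- by move=> n; case: (vqK i n).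
- apply: (weak_cvg_shift (v'P i)); rewrite -oppr0.
  rewrite (_ : (fun _ => _) = fun n => - (v i n - q i n)).
    by apply: cvgN; exact: (cvg_trans (cvg_app _ oF) (vq i)).
  by apply/funext => n; rewrite opprB.
suff : u @ \oo --> - C vb i by exact: cvg_trans (cvg_app _ oF).
rewrite (_ : u = fun n => (gamma n)^-1 *: W i n (v i n - q i n) - C (V n) i); last exact/funext.
rewrite -[X in _ --> X]sub0r; apply: cvgB; last exact: Cv.
apply: norm_cvg0.
apply: (@squeeze_cvgr _ _ _ _ (fun=> 0) (fun n => eps^-1 * alpha^-1 * `|v i n - q i n|)).
- apply: nearW => n; rewrite normr_ge0/= normrZ -mulrA ger0_norm ?invr_ge0 ?(ltW (gamma_gt0 n))//.
  have [_ _ _ Wal _] := W_inv i n.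
  apply: ler_pM => //; first by rewrite invr_ge0 ltW.
  by rewrite lef_pV2 ?posrE//; case/andP: (gamma_bounds n).
- exact: cvg_cst.
- rewrite -[X in _ --> X](mulr0 (eps^-1 * alpha^-1)); apply: cvgMl_tmp.
  by rewrite -(@normr0 _ (G i)); apply: cvg_norm; exact: vq.
Qed.

Lemma W_cvg i x : cvgn (fun n => W i n x).
Proof.
apply: (@metric_limit _ _ (W i) alpha^-1 eta).
- by move=> n; exact: (@sW i n).
- by move=> n y; exact: pW.
- by rewrite invr_ge0 ltW.
- by move=> n y; case: (W_inv i n).
- exact: eta_nns.1.
- exact: eta_nns.2.
- by move=> n y; exact: W_mono.
Qed.

(** The difference of the squared distances to v1 and to v2 converges; up to
    convergent terms it is - 2 sum_i <v i n | W i n (v1 i - v2 i)>.  Computed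
    along F1 and along F2, the limit of this sum must be the same, so that
    sum_i <v1 i - v2 i | d i> = 0 for d the limit of the W i n (v1 i - v2 i). *)
Lemma fb_cluster_uniq v1 v2 (F1 F2 : set_system nat) :
  ProperFilter F1 -> ProperFilter F2 -> \oo `<=` F1 -> \oo `<=` F2 ->
  fb_zero v1 -> fb_zero v2 ->
  (forall i y, (fun n => '<| v i n, y |>) @ F1 --> '<| v1 i, y |>) ->
  (forall i y, (fun n => '<| v i n, y |>) @ F2 --> '<| v2 i, y |>) ->
  forall i, v1 i = v2 i.
Proof.
move=> PF1 PF2 oF1 oF2 z1 z2 w1 w2.
have [K vqK] := fb_bounded z1.
have vK i n : `|v i n| <= K by case: (vqK i n).
have /fin_all_exists[d dP] : forall i, exists d : G i,
    (fun n => W i n (v1 i - v2 i)) @ \oo --> d.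
  by move=> i; apply/cvg_ex; exact: W_cvg.
pose N n := \sum_i '<| v i n, W i n (v1 i - v2 i) |>.
have [l Nl] : exists l : R, N @ \oo --> l.
  have [/cvg_ex[l1 Q1] _ _] := fb_fejer z1.
  have [/cvg_ex[l2 Q2] _ _] := fb_fejer z2.
  have WP x : exists c : 'I_m -> R, forall i, (fun n => '<| W i n (x i), x i |>) @ \oo --> c i.
    have /fin_all_exists[c cP] : forall i, exists c : R,
        (fun n => '<| W i n (x i), x i |>) @ \oo --> c.
      move=> i; have /cvg_ex[y yP] := @W_cvg i (x i).
      by exists '<| y, x i |>; apply: dotp_cvg => //; exact: cvg_cst.
    by exists c.
  have [c1 c1P] := WP v1; have [c2 c2P] := WP v2.
  have NE n : N n = 2^-1 * ((Q v2 n - Q v1 n) +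
     (\sum_i '<| W i n (v1 i), v1 i |> - \sum_i '<| W i n (v2 i), v2 i |>)).
    rewrite /Q -!sumrB -big_split mulr_sumr; apply: eq_bigr => i _ /=.
    rewrite !(linearB (W i n)) !dotpE.
    rewrite (@sW i n (v i n) (v1 i)) (@sW i n (v i n) (v2 i)).
    rewrite (dotpC (W i n (v1 i)) (v i n)) (dotpC (W i n (v2 i)) (v i n)).
    by field.
  exists (2^-1 * ((l2 - l1) + (\sum_i c1 i - \sum_i c2 i))).
  rewrite (_ : N = fun n => 2^-1 * ((Q v2 n - Q v1 n) +
     (\sum_i '<| W i n (v1 i), v1 i |> - \sum_i '<| W i n (v2 i), v2 i |>))); last exact/funext.
  apply: cvgMl_tmp; apply: cvgD; apply: cvgB => //; exact: cvg_sum_fin.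
have lim F (y : forall i, G i) : ProperFilter F -> \oo `<=` F ->
    (forall i t, (fun n => '<| v i n, t |>) @ F --> '<| y i, t |>) ->
    l = \sum_i '<| y i, d i |>.
  move=> PF oF wy; apply: (@cvg_unique _ _ (N @ F)) => //.
    exact: cvg_trans (cvg_app _ oF) Nl.
  apply: cvg_sum_fin => i; apply: (weak_strong_dotp (vK i) (wy i)).
  exact: cvg_trans (cvg_app _ oF) (dP i).
have dl i : mu^-1 * `|v1 i - v2 i| ^+ 2 <= '<| v1 i - v2 i, d i |>.
  have c : (fun n => '<| v1 i - v2 i, W i n (v1 i - v2 i) |>) @ \oo --> '<| v1 i - v2 i, d i |>.
    by apply: dotp_cvg; [exact: cvg_cst | exact: dP].
  have c0 : (fun=> mu^-1 * `|v1 i - v2 i| ^+ 2) @ \oo --> mu^-1 * `|v1 i - v2 i| ^+ 2.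
    exact: cvg_cst.
  apply: (ler_cvg_to c0 c); apply: nearW => n.
  by rewrite ler_pdivrMl// dotpC; case: (W_inv i n).
have s0 : \sum_i '<| v1 i - v2 i, d i |> = 0.
  under eq_bigr do rewrite dotpDl dotpNl.
  by rewrite sumrB -(lim _ _ PF1 oF1 w1) -(lim _ _ PF2 oF2 w2) subrr.
move=> i; have h0 j : 0 <= '<| v1 j - v2 j, d j |>.
  by apply: le_trans (dl j); rewrite mulr_ge0 ?sqr_ge0// invr_ge0 ltW.
have : '<| v1 i - v2 i, d i |> = 0.
  by apply/eqP; move/eqP: s0; rewrite psumr_eq0 => [/allP/(_ i)|j _];
    [apply; rewrite mem_index_enum | exact: h0].
move=> di; have := dl i; rewrite di pmulr_rle0 ?invr_gt0//; exact: sub_sqnorm_le0.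
Qed.

Theorem fb_weak_cvg : (exists vb, fb_zero vb) -> exists vbar, [/\ fb_zero vbar,
  forall i, weakly_cvg (v i) (vbar i) &
  (fun n => \sum_i '<| v i n - vbar i, C (V n) i - C vbar i |>) @ \oo --> (0 : R)].
Proof.
move=> [vb zb].
have [F0 [UF0 oF0]] := @ultraFilterLemma nat \oo _.
have [vbar [zbar wbar]] := fb_cluster zb UF0 oF0.
have weak i : weakly_cvg (v i) (vbar i).
  move=> y; apply: cvg_ultra => F UF oF.
  have [v' [z' w']] := fb_cluster zb UF oF.
  by rewrite (fb_cluster_uniq _ _ oF0 oF zbar z' wbar w').
exists vbar; split=> //.
have [K vqK] := fb_bounded zb.
have [_ _ Cv] := fb_fejer zbar.
rewrite -[X in _ --> X](_ : \sum_(i < m) 0 = 0); last by rewrite big1.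
apply: (@cvg_sum_fin R _ \oo _ (fun j n => '<| v j n - vbar j, C (V n) j - C vbar j |>)) => i.
apply: (weak_sub_strong_dotp (M := K) _ (@weak i)) => [n|]; first by case: (vqK i n).
by apply: cvgB; [exact: Cv | exact: cvg_cst].
Qed.

End VariableMetricForwardBackward.

(** * The primal-dual pair of inclusions *)

Section PrimalDual.
Context {R : realType} {m : nat} {H : hilbertType R} {G : 'I_m -> hilbertType R}.
Variables (z : H) (rho : R) (A : H -> set H) (r : forall i, G i).
Variables (B D : forall i, G i -> set (G i)) (nu : 'I_m -> R).
Variables (L : forall i, {linear H -> G i}).
Hypotheses (rho_gt0 : 0 < rho) (A_max : max_monotone A).
Hypothesis B_max : forall i, max_monotone (@B i).
Hypothesis nu_gt0 : forall i, 0 < nu i.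
Hypothesis D_max : forall i, max_monotone (@D i).
Hypothesis D_strong : forall i, strongly_monotone (nu i) (@D i).
Hypothesis L_bounded : forall i, bounded_near (L i) (nbhs (0 : H)).
Implicit Types v : forall i, G i.

Let X v := primal_of_dual z rho A L v.

(** The single-valued part C of the dual inclusion, which asks for v such that
    - C v belongs to the product of the B_i^-1 v_i; see [dual_solutionE]. *)
Definition dual_op v i : G i := to_fun (op_inv (@D i)) (v i) - L i (X v) + r i.

Lemma D_inv_graph i y : D (to_fun (op_inv (@D i)) y) y.
Proof. exact: strongly_monotone_inv_graph _ (nu_gt0 i) (@D_max i) (@D_strong i). Qed.

Lemma D_inv_uniq i y d : D d y -> d = to_fun (op_inv (@D i)) y.
Proof.
move=> Dd; have := strongly_monotoneP (@D_strong i) Dd (D_inv_graph y).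
rewrite subrr dotp0r pmulr_rle0//; exact: sub_sqnorm_le0.
Qed.

Lemma X_graph v : A (X v) (z - \sum_j adjoint (L j) (v j) - rho *: X v).
Proof. exact: J_scale_graph. Qed.

Lemma dual_solutionE v :
  dual_solution z rho A r B D L v <-> forall i, B (- dual_op v i) (v i).
Proof.
split=> h i.
  have [b Bb [d Dd rE]] := h i.
  suff -> : - dual_op v i = b by [].
  rewrite /dual_op -(D_inv_uniq Dd) -rE; apply: dotp_inj => t; rewrite !dotpE; ring.
have Bh := h i; exists (- dual_op v i) => //.
exists (to_fun (op_inv (@D i)) (v i)); first exact: D_inv_graph.
by rewrite /dual_op; apply: dotp_inj => t; rewrite !dotpE; ring.
Qed.

(** In the sum, the terms - L_i (X v - X v') move to the other side as adjoints,
    and - sum_i L_i^* (v_i - v'_i) is the difference of the points s at which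
    the resolvent of A is evaluated. *)
Lemma dual_op_strong v v' : rho * `|X v - X v'| ^+ 2
    + \sum_i nu i * `|to_fun (op_inv (@D i)) (v i) - to_fun (op_inv (@D i)) (v' i)| ^+ 2
  <= \sum_i '<| v i - v' i, dual_op v i - dual_op v' i |>.
Proof.
set x := X v; set x' := X v'.
have mA := A_max.1.
have hX : rho * `|x - x'| ^+ 2 <= - \sum_i '<| v i - v' i, L i (x - x') |>.
  have := mA _ _ _ _ (X_graph v) (X_graph v').
  have -> : z - \sum_j adjoint (L j) (v j) - rho *: X v -
     (z - \sum_j adjoint (L j) (v' j) - rho *: X v') =
     - \sum_j adjoint (L j) (v j - v' j) - rho *: (x - x').
    have -> : \sum_j adjoint (L j) (v j - v' j) =
        \sum_j adjoint (L j) (v j) - \sum_j adjoint (L j) (v' j).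
      by rewrite -sumrB; apply: eq_bigr => j _; exact: adjointB.
    by rewrite -/x -/x'; apply: dotp_inj => t; rewrite !dotpE; ring.
  rewrite dotpDr !dotpNr dotpZr dotp_norm subr_ge0 => /le_trans; apply.
  rewrite lerN2 dotpC dotp_suml; apply: ler_sum => i _.
  by rewrite dotpC adjointP// dotpC.
have hD : \sum_i nu i * `|to_fun (op_inv (@D i)) (v i) - to_fun (op_inv (@D i)) (v' i)| ^+ 2
   <= \sum_i '<| v i - v' i, to_fun (op_inv (@D i)) (v i) - to_fun (op_inv (@D i)) (v' i) |>.
  apply: ler_sum => i _; rewrite [leRHS]dotpC.
  exact: strongly_monotoneP (@D_strong i) (D_inv_graph _) (D_inv_graph _).
apply: (le_trans (lerD hX hD)); rewrite [leLHS]addrC -sumrB; apply: ler_sum => i _.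
rewrite /dual_op (linearB (L i)) -/x -/x' !dotpE; lra.
Qed.

Lemma primal_dual_solution x : primal_solution z rho A r B D L x ->
  exists v, dual_solution z rho A r B D L v /\ x = X v.
Proof.
move=> [_ [a Aa [_ [u uP <-] <-]] [_ [_ -> <-] zE]].
have /fin_all_exists[v vP] : forall i, exists vi : G i,
    parallel_sum (@B i) (@D i) (L i x - r i) vi /\ adjoint (L i) vi = u i.
  by move=> i; have [vi ? ?] := uP i; exists vi.
have uE : \sum_i u i = \sum_i adjoint (L i) (v i).
  by apply: eq_bigr => i _; case: (vP i).
have xE : x = X v.
  apply: (monotone_resolvent_uniq (s := z - \sum_j adjoint (L j) (v j)) A_max.1 rho_gt0);
    last exact: X_graph.
  suff -> : z - \sum_j adjoint (L j) (v j) - rho *: x = a by [].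
  by rewrite -zE uE addrAC addrK addrK.
exists v; split=> // i; have [[b Bb [d Dd bd]] _] := vP i.
exists b => //; exists d => //; rewrite -/(X v) -xE.
by apply: dotp_inj => t; have := congr1 (fun y => '<| y, t |>) bd; rewrite !dotpE; lra.
Qed.

Lemma dual_primal_solution v : dual_solution z rho A r B D L v ->
  primal_solution z rho A r B D L (X v).
Proof.
move=> dv.
exists (z - rho *: X v); last first.
  by exists (rho *: X v); [exists (X v) | rewrite subrK].
exists (z - \sum_j adjoint (L j) (v j) - rho *: X v); first exact: X_graph.
exists (\sum_j adjoint (L j) (v j)); last by rewrite addrAC subrK.
exists (fun j => adjoint (L j) (v j)) => // i.
exists (v i) => //; have [b Bb [d Dd rE]] := dv i.
exists b => //; exists d => //; rewrite -rE.
by rewrite -/(X v); apply: dotp_inj => t; rewrite !dotpE; lra.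
Qed.

(** The B_i are monotone, so the right-hand side of [dual_op_strong] is nonpositive
    at two dual solutions. *)
Lemma dual_solutions_same_primal v v' :
  dual_solution z rho A r B D L v -> dual_solution z rho A r B D L v' -> X v = X v'.
Proof.
move=> /dual_solutionE dv /dual_solutionE dv'.
have := dual_op_strong v v'.
have : \sum_i '<| v i - v' i, dual_op v i - dual_op v' i |> <= 0.
  apply: sumr_le0 => i _; have := (B_max i).1 _ _ _ _ (dv i) (dv' i).
  by rewrite dotpC !dotpE; lra.
have : 0 <= \sum_i nu i * `|to_fun (op_inv (@D i)) (v i) - to_fun (op_inv (@D i)) (v' i)| ^+ 2.
  by apply: sumr_ge0 => i _; rewrite mulr_ge0 ?sqr_ge0// ltW.
move=> h1 h2 h3.
have h : rho * `|X v - X v'| ^+ 2 <= 0 by lra.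
by apply: sub_sqnorm_le0; rewrite pmulr_rle0// in h.
Qed.

(** Each component of C v - C v' is a difference dD i - L i dx.  Young's inequality
    with the parameter k = N / (rho M) balances the two parts: both coefficients
    then equal 1 / beta = M + N / rho. *)
Lemma dual_op_cocoercive (beta : R) v v' : (0 < m)%N ->
  (forall i, exists x, L i x != 0) ->
  beta = (\big[Num.max/0]_i (nu i)^-1 + rho^-1 * \sum_i opnorm (L i) ^+ 2)^-1 ->
  beta * \sum_i `|dual_op v i - dual_op v' i| ^+ 2 <=
  \sum_i '<| v i - v' i, dual_op v i - dual_op v' i |>.
Proof.
move=> m0 L0 ->.
set N := \sum_i opnorm (L i) ^+ 2; set M := \big[Num.max/0]_i (nu i)^-1.
pose i0 := Ordinal m0.
have Mi i : (nu i)^-1 <= M by apply: le_bigmax.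
have M0 : 0 < M by apply: lt_le_trans (Mi i0); rewrite invr_gt0.
have N0 : 0 < N.
  have [x Lx] := L0 i0; rewrite /N (bigD1 i0)//= ltr_wpDr//.
    by apply: sumr_ge0 => i _; rewrite sqr_ge0.
  rewrite exprn_gt0// lt0r opnorm_ge0// andbT; apply/eqP => o0.
  have := opnorm_le (L_bounded i0) x; rewrite o0 mul0r normr_le0.
  by rewrite (negPf Lx).
have MN : 0 < M + rho^-1 * N by rewrite addr_gt0// mulr_gt0 ?invr_gt0.
rewrite mulrC ler_pdivrMr//; apply: le_trans (ler_wpM2r (ltW MN) (dual_op_strong v v')).
set dD := fun i => to_fun (op_inv (@D i)) (v i) - to_fun (op_inv (@D i)) (v' i).
set dx := X v - X v'.
pose k := N / (rho * M).
have k0 : 0 < k by rewrite divr_gt0 ?mulr_gt0.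
have le_i i : `|dual_op v i - dual_op v' i| ^+ 2 <=
    (1 + k) * M * (nu i * `|dD i| ^+ 2)
    + (1 + k^-1) * `|dx| ^+ 2 * opnorm (L i) ^+ 2.
  have -> : dual_op v i - dual_op v' i = dD i - L i dx.
    by rewrite /dual_op (linearB (L i)) /dD; apply: dotp_inj => t; rewrite !dotpE; ring.
  have h1 : `|dD i - L i dx| ^+ 2 <=
      (1 + k) * `|dD i| ^+ 2 + (1 + k^-1) * `|L i dx| ^+ 2.
    have : 0 <= k^-1 * '<| k *: dD i + L i dx, k *: dD i + L i dx |>.
      by rewrite mulr_ge0 ?invr_ge0 ?(ltW k0)// dotp_norm sqr_ge0.
    rewrite -!dotp_norm !dotpE (dotpC (L i dx)) => hh; rewrite -subr_ge0.
    apply: le_trans hh _; rewrite le_eqVlt; apply/orP; left; apply/eqP.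
    by field; rewrite gt_eqF.
  apply: (le_trans h1); apply: lerD.
    rewrite -mulrA; apply: ler_wpM2l; first by rewrite addr_ge0// ltW.
    rewrite mulrA ler_peMl ?sqr_ge0//.
    by rewrite -(mulVf (lt0r_neq0 (nu_gt0 i))) ler_pM2r.
  rewrite -mulrA; apply: ler_wpM2l; first by rewrite addr_ge0// invr_ge0 ltW.
  rewrite -exprMn mulrC ler_pXn2r ?nnegrE ?mulr_ge0 ?opnorm_ge0//.
  exact: opnorm_le.
apply: (le_trans (ler_sum _ (fun i _ => le_i i))).
rewrite big_split /= -!mulr_sumr -/N.
have kE : (1 + k) * M = M + rho^-1 * N by rewrite /k; field; rewrite !gt_eqF.
have kE' : (1 + k^-1) * N = rho * (M + rho^-1 * N).
  by rewrite /k; field; rewrite !gt_eqF.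
rewrite kE mulrAC kE'; rewrite /dD /dx; lra.
Qed.

End PrimalDual.

(** * The primal-dual algorithm *)

Theorem corollary5p4
  (R : realType) (m : nat) (m_gt0 : (0 < m)%N)
  (H : hilbertType R) (G : 'I_m -> hilbertType R)
  (z : H) (rho : R) (rho_gt0 : 0 < rho)
  (A : H -> set H) (A_max : max_monotone A)
  (r : forall i, G i)
  (B : forall i, G i -> set (G i)) (B_max : forall i, max_monotone (B i))
  (nu : 'I_m -> R) (nu_gt0 : forall i, 0 < nu i)
  (D : forall i, G i -> set (G i)) (D_max : forall i, max_monotone (D i))
  (D_strong : forall i, strongly_monotone (nu i) (D i))
  (L : forall i, {linear H -> G i})
  (L_bounded : forall i, bounded_near (L i) (nbhs (0 : H)))
  (L_neq0 : forall i, exists x, L i x != 0)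
  (z_ran : ran (primal_op rho A r B D L) z)
  (beta : R)
  (beta_def : beta = (\big[Num.max/0]_i (nu i)^-1
                      + rho^-1 * \sum_i opnorm (L i) ^+ 2)^-1)
  (a : nat -> H) (a_summable : cvgn [normed series a])
  (alpha : R) (alpha_gt0 : 0 < alpha)
  (eta : nat -> R) (eta_ge0 : forall n, 0 <= eta n)
  (eta_summable : cvgn (series eta))
  (b d : forall i, nat -> G i)
  (b_summable : forall i, cvgn [normed series (b i)])
  (d_summable : forall i, cvgn [normed series (d i)])
  (U : forall i, nat -> {linear G i -> G i})
  (U_P : forall i n, Palpha alpha (U i n))
  (mu : R)
  (mu_def : mu%:E = \big[maxe/-oo%E]_i
                      ereal_sup (range (fun n => (opnorm (U i n))%:E)))
  (U_mono : forall i n, loewner_ge ((1 + eta n) \*: U i n.+1) (U i n))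
  (eps : R) (eps_gt0 : 0 < eps)
  (eps_le : eps <= Num.min 1 (2 * beta / (mu + 1)))
  (lambda : nat -> R) (lambda_bounds : forall n, eps <= lambda n <= 1)
  (gamma : nat -> R)
  (gamma_bounds : forall n, eps <= gamma n <= (2 * beta - eps) / mu)
  (s x : nat -> H) (v w : forall i, nat -> G i)
  (s_def : forall n, s n = z - \sum_i adjoint (L i) (v i n))
  (x_def : forall n,
     x n = J (op_scale rho^-1 A) (rho^-1 *: s n) + a n)
  (w_def : forall i n,
     w i n = v i n + gamma n *: U i n (L i (x n) - r i
                       - to_fun (op_inv (D i)) (v i n) - d i n))
  (v_def : forall i n,
     v i n.+1 = v i n + lambda n *:
       (J (op_comp (gamma n \*: U i n) (op_inv (B i))) (w i n)
        + b i n - v i n)) :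
  exists xbar : H, unique (primal_solution z rho A r B D L) xbar /\
  exists vbar : forall i, G i,
    [/\ dual_solution z rho A r B D L vbar,
        (forall i, weakly_cvg (v i) (vbar i))
          /\ xbar = primal_of_dual z rho A L vbar
      & x @ \oo --> xbar].
Proof.
have U_le i n y : `|U i n y| <= mu * `|y|.
  have [Ub _ _] := U_P i n.
  apply: (le_trans (opnorm_le Ub y)); apply: ler_wpM2r => //.
  rewrite -lee_fin mu_def.
  apply: (@le_trans _ _ (ereal_sup (range (fun n => (opnorm (U i n))%:E)))).
    by apply: ereal_sup_ubound; exists n.
  exact: (@le_bigmax _ _ _ (-oo)%E (fun i => ereal_sup (range (fun n => (opnorm (U i n))%:E))) i).
(* A nonzero value of L i0 is a vector on which U is bounded from below. *)
have mu_gt0 : 0 < mu.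
  pose i0 := Ordinal m_gt0; have [y Ly] := L_neq0 i0.
  have np : 0 < `|L i0 y| by rewrite normr_gt0.
  rewrite -(pmulr_lgt0 mu np); apply: lt_le_trans (U_le i0 0 (L i0 y)).
  rewrite normr_gt0; apply/eqP => U0.
  have [_ _ /(_ (L i0 y))] := U_P i0 0; rewrite U0 dotp0l dotpZl dotp_norm.
  by rewrite leNgt mulr_gt0// exprn_gt0.
have eta_nns : nnsummable eta by [].
have nns (K : hilbertType R) (u : nat -> K) : cvgn [normed series u] ->
  nnsummable (fun n => `|u n|) by [].
have e_nns i : nnsummable (fun n => `|d i n - L i (a n)|).
  apply: (@nnsummable_le _ _ (fun n => `|d i n| + opnorm (L i) * `|a n|)).
    move=> n; rewrite normr_ge0 /=; apply: (le_trans (ler_normB _ _)).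
    by rewrite lerD2l; exact: opnorm_le.
  apply: nnsummableD; first exact: nns.
  by apply: nnsummableZ; [exact: opnorm_ge0 | exact: nns].
have /fin_all_exists[W W_inv] : forall i, exists Wi : nat -> {linear G i -> G i},
    forall n, inverse_metric alpha mu (U i n) (Wi n).
  move=> i.
  have /choice[Wi WiP] : forall n, exists Wn : {linear G i -> G i}, inverse_metric alpha mu (U i n) Wn.
    by move=> n; exact: (metric_inverse alpha_gt0 (ltW mu_gt0) (U_P i n) (U_le i n)).
  by exists Wi.
pose C := dual_op z rho A r D L.
pose M i := op_inv (B i).
have zeroE vb : fb_zero M C vb <-> dual_solution z rho A r B D L vb.
  by apply: iff_sym; exact: dual_solutionE.
have C_coco v1 v2 := dual_op_cocoercive z r rho_gt0 A_max nu_gt0 D_max D_strong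
  L_bounded v1 v2 m_gt0 L_neq0 beta_def.
(* The error a n of the primal step acts on the dual iteration through L i. *)
have v_rec i n : v i n.+1 = v i n + lambda n *:
    (J (op_comp (gamma n \*: U i n) (M i))
       (v i n - gamma n *: U i n (C (v^~ n) i + (d i n - L i (a n))))
     + b i n - v i n).
  rewrite v_def w_def /M; congr (_ + _ *: (J _ _ + _ - _)).
  rewrite -scalerN -linearN; congr (_ + _ *: U i n _).
  rewrite x_def s_def linearD /C /dual_op /primal_of_dual.
  by apply: dotp_inj => t; rewrite !dotpE; ring.
have [|vbar [zbar weak lim]] := fb_weak_cvg (fun i => max_monotone_inv (B_max i))
  C_coco alpha_gt0 mu_gt0 eta_nns U_P U_le U_mono W_inv eps_gt0 lambda_bounds gamma_bounds
  e_nns (fun i => nns _ _ (b_summable i)) v_rec.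
  have [xs xsP] := z_ran; have [vs [dvs _]] := primal_dual_solution rho_gt0 A_max xsP.
  by exists vs; apply/zeroE.
have dbar := (zeroE _).1 zbar.
pose xbar := primal_of_dual z rho A L vbar.
exists xbar; split.
  split; first exact: dual_primal_solution.
  move=> x' /(primal_dual_solution rho_gt0 A_max)[v' [dv' ->]].
  exact: (dual_solutions_same_primal rho_gt0 A_max B_max nu_gt0 D_max D_strong L_bounded).
exists vbar; split=> //.
have a0 : a @ \oo --> (0 : H).
  apply: norm_cvg0; exact: cvg_series_cvg_0.
have xx : (fun n => primal_of_dual z rho A L (v^~ n) - xbar) @ \oo --> (0 : H).
  apply: (@sq_le_cvg0 _ _ _ (fun n => rho^-1 * \sum_i '<| v i n - vbar i, C (v^~ n) i - C vbar i |>)).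
    move=> n; rewrite ler_pdivlMl//.
    apply: le_trans (dual_op_strong z r rho_gt0 A_max nu_gt0 D_max D_strong L_bounded _ _).
    by rewrite lerDl; apply: sumr_ge0 => i _; rewrite mulr_ge0 ?sqr_ge0// ltW.
  by rewrite -[X in _ --> X](mulr0 rho^-1); apply: cvgMl_tmp.
rewrite (_ : x = fun n => primal_of_dual z rho A L (v^~ n) + a n).
  rewrite -[X in _ --> X]addr0; apply: cvgD => //; exact/subr_cvg0.
by apply/funext => n; rewrite x_def s_def.
Qed.
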